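(* Let $T$ be a triangulation of a closed connected surface $M$ with vertices $V=\{v_1,\dots,v_N\}$, and let $d$ be a PL metric associated to $T$. The following hold. (a) Under the combinatorial Yamabe flow $\frac{du_i}{dt}=-u_iK_i$, $u_i(0)=1$, the curvature evolves according to an equation of the form $$\frac{dK_i}{dt}=\sum_{j=1}^N c_{ij}K_j,\qquad i=1,\dots,N,$$ where (at each time) the matrix $[c_{ij}]_{N\times N}$ is symmetric and negative semi-definite. In particular, $\sum_{i=1}^N K_i(t)^2$ is decreasing (i.e. non-increasing) in time $t$. (b) The combinatorial Yamabe flow is variational: after the change of variables $w_i=\log u_i$, there is a locally convex function $f$ of $w=(w_1,\dots,w_N)$, defined on the open set of all $w\in\mathbb{R}^N$ for which $u=(e^{w_1},\dots,e^{w_N})$ makes $u*d$ a PL metric, such that the combinatorial Yamabe flow is the negative gradient flow $\frac{dw_i}{dt}=-\frac{\partial f}{\partial w_i}$ of $f$. (c) (Local rigidity) The curvature map $$K:\Big\{u=(u_1,\dots,u_N)\in\mathbb{R}^N_{>0}\ \Big|\ \prod_{i=1}^N u_i=1,\ u*d\text{ is a PL metric}\Big\}\to\Big\{(k_1,\dots,k_N)\in\mathbb{R}^N\ \Big|\ \sum_{i=1}^N k_i=2\pi\chi(M)\Big\},$$ sending $u$ to the curvature $(K_1,\dots,K_N)$ of the metric $u*d$, is a local homeomorphism.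
   Context: Let $E$ be the set of edges of $T$. A PL metric (piecewise flat metric) associated to $T$ is a function $d:E\to\mathbb{R}_{>0}$ such that for every triangle of $T$ the three values of $d$ on its edges satisfy the strict triangle inequalities; each triangle is identified with the Euclidean triangle with these edge lengths. Write $d_{ij}=d(v_iv_j)$. Given $u:V\to\mathbb{R}_{>0}$, $u_i=u(v_i)$, define $u*d:E\to\mathbb{R}_{>0}$ by $(u*d)(v_iv_j)=u_iu_jd_{ij}$; $u$ is a conformal factor for $d$ if $u*d$ is again a PL metric. The curvature of a PL metric at $v_i$ is $2\pi$ minus the sum of the inner angles at $v_i$ of all triangles of $T$ having $v_i$ as a vertex. In the combinatorial Yamabe flow, $u(t)=(u_1(t),\dots,u_N(t))$ is a conformal factor for $d$ for each $t$ and $K_i=K_i(t)$ is the curvature at $v_i$ of the PL metric $u(t)*d$. A function on an open subset of $\mathbb{R}^N$ is locally convex if every point has a convex neighbourhood on which the function is convex. *)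

(* Defs.v *)
From HB Require Import structures.
From mathcomp Require Import all_boot all_order all_algebra.
From mathcomp Require Import all_classical all_reals all_analysis.
Import numFieldNormedType.Exports.

Set Implicit Arguments.
Unset Strict Implicit.
Unset Printing Implicit Defensive.

Import Order.TTheory GRing.Theory Num.Theory.

Local Open Scope ring_scope.

(* A triangulation with vertices v_1, ..., v_N is a finite abstract simplicial
   complex, given by the set [T] of its triangles (3-element sets of vertices);
   its edges are the 2-element subsets of its triangles. *)
Definition edges (N : nat) (T : {set {set 'I_N}}) : {set {set 'I_N}} :=
  [set e : {set 'I_N} | (#|e| == 2) && [exists t in T, e \subset t]].

(* The link of [v] is the graph on the other vertices in which [x] and [y] are
   adjacent when {v, x, y} is a triangle.  It is the (cyclic) sequence
   [s = [:: s_0; ...; s_(n-1)]] when the triangles at [v] are exactly the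
   {v, s_k, s_(k+1)}, indices mod n. *)
Definition link_is_cycle (N : nat) (T : {set {set 'I_N}}) (v : 'I_N) : Prop :=
  exists s : seq 'I_N,
    [/\ uniq s, (2 < size s)%N
      & forall x y : 'I_N, ([set v; x; y] \in T) =
          (x \in s) && ((y == next s x) || (y == prev s x))].

(* A closed surface is the realization of a finite simplicial complex of
   dimension 2 in which every vertex link is a circle; connectedness is
   connectedness of the 1-skeleton.  Every element of 'I_N is a vertex of [T],
   since its link is nonempty. *)
Definition triangulates_closed_connected_surface
    (N : nat) (T : {set {set 'I_N}}) : Prop :=
  [/\ (0 < N)%N,
      (forall t, t \in T -> #|t| = 3),
      (forall v, link_is_cycle T v)
    & (forall v w : 'I_N,
         connect [rel x y | [set x; y] \in edges T] v w)].

Definition euler_characteristic (N : nat) (T : {set {set 'I_N}}) : int :=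
  N%:Z - #|edges T|%:Z + #|T|%:Z.

Section PLMetric.
Context {R : realType} {N : nat}.
Implicit Types (T : {set {set 'I_N}}) (v : 'I_N).
(* Only the values of [d] on the edges are meaningful. *)
Implicit Types (d : {set 'I_N} -> R) (u w : 'rV[R]_N).

(* In a triangle [t], the side opposite to the vertex [v] is [t :\ v], and the
   two sides at [v] are the [set v; x] for [x] in [t :\ v]. *)
Definition PL_metric T d : Prop :=
  (forall e, e \in edges T -> 0 < d e) /\
  (forall (t : {set 'I_N}) v, t \in T -> v \in t ->
     d (t :\ v) < \sum_(x in t :\ v) d [set v; x]).

(* Law of cosines: the angle opposite to the side a is
   acos ((b^2 + c^2 - a^2) / (2 b c)). *)
Definition inner_angle d (t : {set 'I_N}) v : R :=
  acos ((\sum_(x in t :\ v) d [set v; x] ^+ 2 - d (t :\ v) ^+ 2)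
        / (2 * \prod_(x in t :\ v) d [set v; x])).

Definition curvature T d v : R :=
  2 * pi - \sum_(t in T | v \in t) inner_angle d t v.

(* u * d *)
Definition rescale u d : {set 'I_N} -> R :=
  fun e => (\prod_(i in e) u 0 i) * d e.

Definition conformal_factor T d u : Prop :=
  (forall i, 0 < u 0 i) /\ PL_metric T (rescale u d).

(* K_i for the metric u * d *)
Definition K T d u : 'rV[R]_N := \row_i curvature T (rescale u d) i.

Definition log_coords u : 'rV[R]_N := \row_i ln (u 0 i).
Definition exp_coords w : 'rV[R]_N := \row_i expR (w 0 i).

Local Open Scope classical_set_scope.

(* x'(t) = l, the limit of the difference quotient being taken in [J], hence
   one-sided if t is an end point of the interval [J]. *)
Definition has_derivative_within (J : set R) (x : R -> R) (t l : R) : Prop :=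
  (x s - x t) / (s - t) @[s --> within J t^'] --> l.

(* u(t), for t in [J], is a conformal factor and du_i/dt = - u_i K_i. *)
Definition yamabe_flow T d (J : set R) (u : R -> 'rV[R]_N) : Prop :=
  forall t, J t ->
    conformal_factor T d (u t) /\
    forall i, has_derivative_within J (fun s => u s 0 i) t
                (- (u t 0 i * K T d (u t) 0 i)).

(* dw_i/dt = - (partial f / partial w_i)(w(t)) *)
Definition negative_gradient_flow (f : 'rV[R]_N -> R) (J : set R)
    (w : R -> 'rV[R]_N) : Prop :=
  forall t, J t -> forall i,
    has_derivative_within J (fun s => w s 0 i) t
      (- 'D_(delta_mx 0 i) f (w t)).

Definition negative_semidefinite (A : 'M[R]_N) : Prop :=
  forall x : 'rV[R]_N, (x *m A *m x^T) 0 0 <= 0.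

Definition locally_convex_on (D : set 'rV[R]_N) (f : 'rV[R]_N -> R) : Prop :=
  forall w, D w -> exists U : set 'rV[R]_N,
    [/\ nbhs w U, U `<=` D, convex_set U & convex_function U f].

End PLMetric.

Local Open Scope classical_set_scope.

(* [f] restricts to a local homeomorphism from the subspace [A] to the subspace
   [B]: every point of [A] has a neighbourhood A `&` U open in [A] that [f] maps
   homeomorphically (with inverse [g]) onto a set B `&` W open in [B]. *)
Definition local_homeomorphism (X Y : topologicalType) (A : set X) (B : set Y)
    (f : X -> Y) : Prop :=
  (forall x, A x -> B (f x)) /\
  forall x, A x -> exists (U : set X) (W : set Y) (g : Y -> X),
    [/\ open U /\ U x,
        open W /\ f @` (A `&` U) = B `&` W,
        forall y, (A `&` U) y -> g (f y) = y,
        {within A `&` U, continuous f}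
      & {within B `&` W, continuous g}].

(* Main.v *)
Require Import Defs.
From HB Require Import structures.
From mathcomp Require Import all_boot all_order all_algebra.
From mathcomp Require Import ring lra.
From mathcomp Require Import all_classical all_reals all_analysis.
Import numFieldNormedType.Exports.
Import Order.TTheory GRing.Theory Num.Theory.

(** Work in the coordinates [w = log u].  In a Euclidean triangle whose sides
    are rescaled by [u], the angle at [i] varies by
<<
      d theta_i = cot theta_k (dw_j - dw_i) + cot theta_j (dw_k - dw_i),
>>
    so the Jacobian of the angles of one triangle in [w] is symmetric, and the
    quadratic form it defines is a negative multiple of the Dirichlet energy of
    linear functions on the triangle ([has_derivative_within_inner_angle],
    [angle_energy_le0]).  Summing over the triangles, the curvature has Jacobian
    [- angle_matrix] in [w]; this is a symmetric positive semi-definite matrix,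
    and by connectedness its kernel consists of the constant vectors
    ([angle_matrix_lt0]).

    Part (a) is then the chain rule: along the flow [dw_i/dt = - K_i], hence
    [dK/dt = angle_matrix K], and the derivative of the sum of the [K_i^2] is a
    nonpositive quadratic form.

    For part (b) a potential of [K] has to be exhibited on a domain that need not
    be simply connected.  There is an explicit one, a sum over the triangles:
    with [l_i] the side opposite to the vertex [i] and [L] the Lobachevsky
    function, an antiderivative of [- ln (2 sin)], the sum of the
    [theta_i ln l_i + L theta_i] has differential the sum of the
    [theta_i d ln l_i], because the remaining terms
    [(ln l_i - ln (2 sin theta_i)) d theta_i] have by the sine rule a common
    factor and the sum of the angles is constant
    ([has_derivative_within_triangle_potential]); adding a linear function of [w]
    gives a potential of [K].  It is convex on every ball in its domain because
    its gradient is monotone along segments.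

    For part (c), on the hyperplane where the sum of the [w_i] vanishes the
    gradient [K] is strictly monotone along segments, so it is injective on a
    small ball; it reaches every [k] near [K w0] because the minimum of [f - <k, w>] over the ball is interior
    ([gradient_surjective]); and its inverse is continuous by compactness
    ([gradient_inverse_continuous]).  The sum of the curvatures is the one
    required by Gauss-Bonnet, because the angles of a triangle add up to [pi]
    and every edge lies in exactly two triangles ([gauss_bonnet]). *)

Local Open Scope ring_scope.

Set Implicit Arguments.
Unset Strict Implicit.
Unset Printing Implicit Defensive.

(** * One-sided derivatives of curves *)

Section CurveCalculus.
Local Open Scope classical_set_scope.
Local Open Scope ring_scope.
Context {R : realType}.
Implicit Types (J : set R) (x y : R -> R) (t l m : R).

Lemma near_dnbhs_within J t (P : R -> Prop) :
  (forall s, J s -> s != t -> P s) -> \forall s \near within J t^', P s.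
Proof.
move=> JP; rewrite near_withinE; near=> s => Js; apply: JP => //.
by near: s; exact: nbhs_dnbhs_neq.
Unshelve. all: by end_near.
Qed.

Lemma has_derivative_within_eq J x y t l :
  J t -> (forall s, J s -> x s = y s) ->
  has_derivative_within J x t l -> has_derivative_within J y t l.
Proof.
move=> Jt xy; apply: cvg_trans; apply: near_eq_cvg.
by apply: near_dnbhs_within => s Js _; rewrite !xy.
Qed.

Lemma has_derivative_within_cst J (a : R) t :
  has_derivative_within J (fun=> a) t 0.
Proof.
rewrite /has_derivative_within; under eq_fun do rewrite subrr mul0r.
exact: cvg_cst.
Qed.

Lemma has_derivative_within_id J t : has_derivative_within J id t 1.
Proof.
have : (cst 1 : R -> R) s @[s --> within J t^'] --> (1 : R) by exact: cvg_cst.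
apply: cvg_trans.
apply: near_eq_cvg; apply: near_dnbhs_within => s _ st /=.
by rewrite divff// subr_eq0.
Qed.

Lemma has_derivative_within_cvg J x t l :
  has_derivative_within J x t l -> x s @[s --> within J t^'] --> x t.
Proof.
move=> xl.
have ct : (s : R) - t @[s --> within J t^'] --> 0.
  rewrite -(subrr t); apply: cvgB; last exact: cvg_cst.
  move=> A /nbhs_dnbhs tA; rewrite /within /= /nbhs /=.
  by apply: filterS tA => s As _.
have : (x s - x t) / (s - t) * (s - t) + x t @[s --> within J t^'] --> x t.
  rewrite -[X in _ --> X](add0r (x t)) -[X in X + _](mulr0 l).
  by apply: cvgD; [exact: cvgM | exact: cvg_cst].
apply: cvg_trans; apply: near_eq_cvg.
by apply: near_dnbhs_within => s _ st /=; rewrite divfK ?subr_eq0// subrK.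
Qed.

Lemma has_derivative_withinD J x y t l m :
  has_derivative_within J x t l -> has_derivative_within J y t m ->
  has_derivative_within J (fun s => x s + y s) t (l + m).
Proof.
move=> xl ym; rewrite /has_derivative_within.
under eq_fun do rewrite opprD addrACA mulrDl.
exact: cvgD.
Qed.

Lemma has_derivative_withinM J x y t l m :
  has_derivative_within J x t l -> has_derivative_within J y t m ->
  has_derivative_within J (fun s => x s * y s) t (l * y t + x t * m).
Proof.
move=> xl ym; rewrite /has_derivative_within.
have -> : (fun s => (x s * y s - x t * y t) / (s - t)) =
    (fun s => (x s - x t) / (s - t) * y t + x s * ((y s - y t) / (s - t))).
  by apply/funext => s; ring.
apply: cvgD; first by apply: cvgM => //; exact: cvg_cst.
by apply: cvgM => //; exact: has_derivative_within_cvg xl.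
Qed.

(** The difference quotient of the outer function extends continuously, so that
    the filter along which the inner variable tends does not matter. *)
Lemma has_derivative_within_comp J x (F : R -> R) t l m :
  is_derive (x t) 1 F m -> has_derivative_within J x t l ->
  has_derivative_within J (fun s => F (x s)) t (m * l).
Proof.
case/is_derive1_caratheodory => q [Fq cq <-] xl; rewrite /has_derivative_within.
under eq_fun do rewrite Fq -mulrA.
apply: cvgM => //.
exact: (cvg_comp _ _ (has_derivative_within_cvg xl) cq).
Qed.

Lemma has_derivative_withinZ J x t a l :
  has_derivative_within J x t l ->
  has_derivative_within J (fun s => a * x s) t (a * l).
Proof.
move=> xl; have := has_derivative_withinM (has_derivative_within_cst J a t) xl.
by rewrite mul0r add0r.
Qed.

Lemma has_derivative_withinN J x t l :
  has_derivative_within J x t l ->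
  has_derivative_within J (fun s => - x s) t (- l).
Proof.
move=> /(@has_derivative_withinZ J x t (-1) l); rewrite mulN1r.
by under eq_fun do rewrite mulN1r.
Qed.

Lemma has_derivative_withinB J x y t l m :
  has_derivative_within J x t l -> has_derivative_within J y t m ->
  has_derivative_within J (fun s => x s - y s) t (l - m).
Proof. by move=> xl /has_derivative_withinN; exact: has_derivative_withinD. Qed.

Lemma has_derivative_within_sum J (I : Type) (r : seq I) (P : pred I)
    (x : I -> R -> R) (l : I -> R) t :
  (forall i, P i -> has_derivative_within J (x i) t (l i)) ->
  has_derivative_within J (fun s => \sum_(i <- r | P i) x i s) t
    (\sum_(i <- r | P i) l i).
Proof.
move=> xl; elim: r => [|i r IH].
  rewrite big_nil; under [X in has_derivative_within _ X]eq_fun do rewrite big_nil.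
  exact: has_derivative_within_cst.
rewrite big_cons; under [X in has_derivative_within _ X]eq_fun do rewrite big_cons.
by case: ifP => // /xl xi; exact: has_derivative_withinD.
Qed.

Lemma has_derivative_withinS J J' x t l :
  J' `<=` J -> has_derivative_within J x t l -> has_derivative_within J' x t l.
Proof.
move=> JJ; apply: cvg_trans => A; rewrite /nbhs/= /within/= /nbhs/=.
by apply: filterS => s As /JJ.
Qed.

Lemma is_derive_of_within J x t l :
  nbhs t J -> has_derivative_within J x t l -> is_derive t 1 x l.
Proof.
move=> Jt xl; apply/is_derive1_caratheodory.
exists (fun z => if z == t then l else (x z - x t) / (z - t)); split.
- move=> z; case: eqP => [->|/eqP]; first by rewrite !subrr mulr0.
  by rewrite -subr_eq0 => /divfK->.
- apply/continuous_withinNx; rewrite eqxx.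
  have xl' : (x s - x t) / (s - t) @[s --> t^'] --> l.
    move=> A lA.
    have : \forall s \near within J t^', A ((x s - x t) / (s - t)) := xl A lA.
    rewrite near_withinE => H.
    have Jt' : \forall s \near t^', J s by exact: nbhs_dnbhs.
    by apply: filterS2 H Jt' => s; apply.
  apply: cvg_trans xl'; apply: near_eq_cvg; near=> s.
  by rewrite ifN//; near: s; exact: nbhs_dnbhs_neq.
- by rewrite eqxx.
Unshelve. all: by end_near.
Qed.

Lemma has_derivative_within_is_derive J x t l :
  is_derive t 1 x l -> has_derivative_within J x t l.
Proof.
move=> xl; have := has_derivative_within_comp xl (has_derivative_within_id J t).
by rewrite mulr1.
Qed.

Lemma has_derivative_withinV J x t l :
  x t != 0 -> has_derivative_within J x t l ->
  has_derivative_within J (fun s => (x s)^-1) t (- (x t) ^- 2 * l).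
Proof.
move=> xt0; apply: (has_derivative_within_comp (F := GRing.inv)).
have := is_deriveV (f := id) xt0 (is_derive_id (x t) 1).
by rewrite [_ *: _]mulr1.
Qed.

Lemma has_derivative_within_sqr J x t l : has_derivative_within J x t l ->
  has_derivative_within J (fun s => x s ^+ 2) t (2 * x t * l).
Proof.
move=> xl; rewrite (_ : 2 * x t * l = l * x t + x t * l); last by ring.
exact: has_derivative_withinM.
Qed.

(** Differentiability relative to the closed interval gives differentiability
    inside and, at the end points, the continuity that the mean value theorem
    asks for. *)
Lemma has_derivative_within_MVT x (l : R -> R) a b :
  a < b ->
  (forall t, t \in `[a, b] -> has_derivative_within `[a, b]%classic x t (l t)) ->
  exists2 c, c \in `]a, b[ & x b - x a = l c * (b - a).
Proof.
move=> ab xl; apply: MVT => //.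
- move=> t tab; apply: (@is_derive_of_within `[a, b]%classic).
    apply: filterS (near_in_itvoo tab); exact: subset_itv_oo_cc.
  by apply: xl; exact: subset_itv_oo_cc tab.
- apply/subspace_continuousP => t tab A xA.
  have /= xt := has_derivative_within_cvg (xl t tab).
  have : \forall s \near within `[a, b]%classic t^', A (x s) := xt A xA.
  rewrite near_withinE /dnbhs near_withinE => H.
  suff : \forall s \near within `[a, b]%classic (nbhs t), A (x s) by [].
  rewrite near_withinE; apply: filterS H => s H sab.
  have [->|st] := eqVneq s t; [exact: nbhs_singleton | exact: H].
Qed.

End CurveCalculus.

(** * Euclidean triangles *)

Section EuclideanTriangle.
Context {R : realType}.
Implicit Types a b c : R.

Definition is_triangle a b c : Prop :=
  [/\ 0 < a, 0 < b & 0 < c] /\ [/\ a < b + c, b < c + a & c < a + b].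

Definition cos_law a b c : R := (b ^+ 2 + c ^+ 2 - a ^+ 2) / (2 * (b * c)).

(** Four times the area, by Heron's formula. *)
Definition area4 a b c : R :=
  Num.sqrt ((a ^+ 2 + b ^+ 2 + c ^+ 2) ^+ 2 - 2 * (a ^+ 4 + b ^+ 4 + c ^+ 4)).

Lemma is_triangle_rot a b c : is_triangle a b c -> is_triangle b c a.
Proof. by case=> -[? ? ?] [? ? ?]; do 2 split. Qed.

Lemma area4_rot a b c : area4 b c a = area4 a b c.
Proof. by rewrite /area4; congr Num.sqrt; ring. Qed.

Lemma heron_gt0 a b c : is_triangle a b c ->
  0 < (a ^+ 2 + b ^+ 2 + c ^+ 2) ^+ 2 - 2 * (a ^+ 4 + b ^+ 4 + c ^+ 4).
Proof.
case=> -[a0 b0 c0] [abc bca cab].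
have -> : (a ^+ 2 + b ^+ 2 + c ^+ 2) ^+ 2 - 2 * (a ^+ 4 + b ^+ 4 + c ^+ 4) =
  (a + b + c) * (b + c - a) * (c + a - b) * (a + b - c) by ring.
by rewrite !mulr_gt0 ?subr_gt0// !addr_gt0.
Qed.

Lemma area4_gt0 a b c : is_triangle a b c -> 0 < area4 a b c.
Proof. by move=> /heron_gt0; rewrite sqrtr_gt0. Qed.

Lemma sqr_area4 a b c : is_triangle a b c -> area4 a b c ^+ 2 =
  (a ^+ 2 + b ^+ 2 + c ^+ 2) ^+ 2 - 2 * (a ^+ 4 + b ^+ 4 + c ^+ 4).
Proof. by move=> /heron_gt0 /ltW; exact: sqr_sqrtr. Qed.

Lemma cos_law_sqr a b c : is_triangle a b c ->
  1 - cos_law a b c ^+ 2 = (area4 a b c / (2 * (b * c))) ^+ 2.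
Proof.
move=> abc; rewrite [RHS]exprMn sqr_area4//; case: abc => -[a0 b0 c0] _.
by rewrite /cos_law; field; rewrite !gt_eqF.
Qed.

Lemma cos_law_itv a b c : is_triangle a b c -> -1 < cos_law a b c < 1.
Proof.
move=> abc; rewrite -ltr_norml -(@expr_lt1 _ 2)// -normrX ger0_norm ?sqr_ge0//.
rewrite -subr_gt0 cos_law_sqr// exprn_gt0// divr_gt0 ?area4_gt0//.
by case: abc => -[a0 b0 c0] _; rewrite !mulr_gt0.
Qed.

Lemma cos_law_itvcc a b c : is_triangle a b c -> -1 <= cos_law a b c <= 1.
Proof. by move=> /cos_law_itv /andP[/ltW -> /ltW ->]. Qed.

Lemma sin_acos_cos_law a b c : is_triangle a b c ->
  sin (acos (cos_law a b c)) = area4 a b c / (2 * (b * c)).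
Proof.
move=> abc; rewrite sin_acos ?cos_law_itvcc// cos_law_sqr// sqrtr_sqr ger0_norm//.
by case: (abc) => -[a0 b0 c0] _; rewrite ltW// divr_gt0 ?area4_gt0// !mulr_gt0.
Qed.

Lemma cos_acos_cos_law a b c : is_triangle a b c ->
  cos (acos (cos_law a b c)) = cos_law a b c.
Proof. by move=> /cos_law_itvcc ?; rewrite acosK// in_itv. Qed.

Lemma acos_cos_law_gt0 a b c : is_triangle a b c -> 0 < acos (cos_law a b c).
Proof. by move=> /cos_law_itv /andP[l u]; rewrite acos_gt0// u ltW. Qed.

Lemma acos_cos_law_ltpi a b c : is_triangle a b c -> acos (cos_law a b c) < pi.
Proof. by move=> /cos_law_itv /andP[l u]; rewrite acos_ltpi// l ltW. Qed.

(** The sum of two angles has the cosine of the supplement of the third one, and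
    its sine is positive, so it lies below pi, where the cosine is injective. *)
Lemma triangle_angle_sum a b c : is_triangle a b c ->
  acos (cos_law a b c) + acos (cos_law b c a) + acos (cos_law c a b) = pi.
Proof.
move=> abc; have bca := is_triangle_rot abc; have cab := is_triangle_rot bca.
set A := acos _; set B := acos (cos_law b c a); set C := acos _.
have [a0 b0 c0] : [/\ 0 < a, 0 < b & 0 < c] by case: abc.
have cAB : cos (A + B) = cos (pi - C).
  rewrite cosD [pi - C]addrC cosDpi cosN !cos_acos_cos_law// !sin_acos_cos_law//.
  rewrite (area4_rot a b c) [X in _ - X]mulf_div -expr2 sqr_area4// /cos_law.
  by field; rewrite !gt_eqF.
have sAB : 0 < sin (A + B).
  rewrite sinD !cos_acos_cos_law// !sin_acos_cos_law// (area4_rot a b c).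
  have -> : area4 a b c / (2 * (b * c)) * cos_law b c a +
      cos_law a b c * (area4 a b c / (2 * (c * a))) = area4 a b c / (2 * (a * b)).
    by rewrite /cos_law; field; rewrite !gt_eqF.
  by rewrite divr_gt0 ?area4_gt0// !mulr_gt0.
have A0 := acos_cos_law_gt0 abc; have Api := acos_cos_law_ltpi abc.
have B0 := acos_cos_law_gt0 bca; have Bpi := acos_cos_law_ltpi bca.
have C0 := acos_cos_law_gt0 cab; have Cpi := acos_cos_law_ltpi cab.
have ABpi : A + B <= pi.
  rewrite leNgt; apply/negP => piAB; move: sAB; rewrite ltNge => /negP; apply.
  have -> : A + B = (A + B - pi) + pi by rewrite subrK.
  rewrite sinDpi oppr_le0 sin_ge0_pi//; apply/andP; split; first lra.
  by have := conj Api Bpi; rewrite -/A -/B; lra.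
suff : A + B = pi - C by move=> ->; rewrite subrK.
apply: cos_inj => //; rewrite in_itv/=; apply/andP; split => //.
- by rewrite addr_ge0// ltW.
- by rewrite subr_ge0 ltW.
- by rewrite gerBl ltW.
Qed.

(** [al], [be] and [ga] are the logarithmic derivatives of the sides.  The square
    root in the derivative of [acos] is four times the area up to the factor
    [2 * b * c], by Heron's formula. *)
Lemma has_derivative_within_angle (J : set R) (a b c : R -> R) t al be ga :
  is_triangle (a t) (b t) (c t) ->
  has_derivative_within J a t (a t * al) ->
  has_derivative_within J b t (b t * be) ->
  has_derivative_within J c t (c t * ga) ->
  has_derivative_within J (fun s => acos (cos_law (a s) (b s) (c s))) t
    ((2 * a t ^+ 2 * al - (a t ^+ 2 + b t ^+ 2 - c t ^+ 2) * be
      - (c t ^+ 2 + a t ^+ 2 - b t ^+ 2) * ga) / area4 (a t) (b t) (c t)).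
Proof.
move=> abc da db dc; case: (abc) => -[a0 b0 c0] _.
have S0 := area4_gt0 abc.
have dbc : has_derivative_within J (fun s => (2 * (b s * c s))^-1) t
    (- (2 * (b t * c t))^-1 * (be + ga)).
  have bc0 : 2 * (b t * c t) != 0 by rewrite !mulf_neq0// gt_eqF.
  have dbc := has_derivative_withinZ (a := 2) (has_derivative_withinM db dc).
  have := has_derivative_withinV (x := fun s => 2 * (b s * c s)) bc0 dbc.
  by congr has_derivative_within; field; rewrite !gt_eqF.
have dcos := has_derivative_withinM
  (has_derivative_withinB
     (has_derivative_withinD (has_derivative_within_sqr db)
        (has_derivative_within_sqr dc))
     (has_derivative_within_sqr da)) dbc.
have := has_derivative_within_comp
  (x := fun s => cos_law (a s) (b s) (c s)) (is_derive1_acos (cos_law_itv abc)) dcos.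
rewrite cos_law_sqr// sqrtr_sqr ger0_norm; last first.
  by rewrite ltW// divr_gt0// !mulr_gt0.
congr has_derivative_within.
move: (area4 _ _ _) S0 => S S0.
by field; rewrite !gt_eqF.
Qed.

End EuclideanTriangle.

(** * The Lobachevsky function *)

Section Antiderivative.
Local Open Scope classical_set_scope.
Local Open Scope ring_scope.
Context {R : realType}.
Implicit Types (f g F G : R -> R) (a b c x y : R).
Local Notation mu := (@lebesgue_measure R).

Lemma antiderivative_unique G1 G2 g a b c x :
  c \in `]a, b[ -> x \in `]a, b[ ->
  (forall y, y \in `]a, b[ -> is_derive y 1 G1 (g y)) ->
  (forall y, y \in `]a, b[ -> is_derive y 1 G2 (g y)) ->
  G1 c = G2 c -> G1 x = G2 x.
Proof.
move=> cab xab d1 d2 e.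
have eqd (p q : R) : p \in `]a, b[ -> q \in `]a, b[ -> p < q ->
    G1 q - G2 q = G1 p - G2 p.
  rewrite !in_itv/= => /andP[ap _] /andP[_ qb] pq.
  have d : forall t, t \in `[p, q] -> has_derivative_within `[p, q]%classic
      (fun s => G1 s - G2 s) t (g t - g t).
    move=> t; rewrite in_itv/= => /andP[pt tq].
    have tab : t \in `]a, b[ by rewrite in_itv/= (lt_le_trans ap pt) (le_lt_trans tq qb).
    by apply: has_derivative_withinB; apply: has_derivative_within_is_derive; auto.
  have [t _ /eqP] := has_derivative_within_MVT pq d.
  by rewrite subrr mul0r subr_eq0 => /eqP.
have [xc|cx|->//] := ltgtP x c.
- by apply/eqP; rewrite -subr_eq0 -(eqd _ _ xab cab xc) e subrr.
- by apply/eqP; rewrite -subr_eq0 (eqd _ _ cab xab cx) e subrr.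
Qed.

(** The fundamental theorem of calculus needs integrability up to the left end
    point, hence a function continuous on the closed interval. *)
Lemma antiderivative_of_closed g a b : a < b ->
  {within `[a, b], continuous g} ->
  (forall x, x \in `]a, b[ -> {for x, continuous g}) ->
  exists G, forall x, x \in `]a, b[ -> is_derive x 1 G (g x).
Proof.
move=> ab gc gx.
exists (fun y => (\int[mu]_(t in `[a, y]) g t)%R) => x xab.
have ig : mu.-integrable `[a, b] (EFin \o g).
  by apply: continuous_compact_integrable => //; exact: segment_compact.
have := gx x xab; move: xab; rewrite in_itv/= => /andP[ax xb] cgx.
have [dG dGE] := continuous_FTC1_closed xb ig ax cgx.
by rewrite derive1E in dGE; exact: (DeriveDef dG dGE).
Qed.

(** The antiderivatives on slightly smaller closed intervals are glued after
    being normalized to vanish at the midpoint. *)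
Lemma antiderivative_exists g a b : a < b ->
  (forall x, x \in `]a, b[ -> {for x, continuous g}) ->
  exists G, forall x, x \in `]a, b[ -> is_derive x 1 G (g x).
Proof.
move=> ab gc; pose c := (a + b) / 2.
have cE e : e < (b - a) / 2 -> c \in `](a + e), (b - e)[.
  by rewrite in_itv/= /c => ?; apply/andP; split; lra.
have /choice[G GP] : forall e : R, exists G, 0 < e < (b - a) / 2 ->
    G c = 0 /\ forall x, x \in `](a + e), (b - e)[ -> is_derive x 1 G (g x).
  move=> e; have [/andP[e0 e2]|_] := boolP (0 < e < (b - a) / 2); last by exists g.
  have [| | |G dG] := @antiderivative_of_closed g (a + e) (b - e).
  - lra.
  - apply: continuous_in_subspaceT => x; rewrite inE/= in_itv/= => /andP[ax xb].
    by apply: gc; rewrite in_itv/=; apply/andP; split; lra.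
  - move=> x; rewrite in_itv/= => /andP[ax xb].
    by apply: gc; rewrite in_itv/=; apply/andP; split; lra.
  exists (fun x => G x - G c) => _; split; first exact: subrr.
  move=> x /dG d; rewrite -(subr0 (g x)); apply: is_deriveB.
pose e x := Num.min (x - a) (b - x) / 2.
have eP x : x \in `]a, b[ -> 0 < e x < (b - a) / 2 /\ x \in `](a + e x), (b - e x)[.
  rewrite !in_itv/= /e minEle => /andP[ax xb].
  by case: ifP => h; split; apply/andP; split; lra.
exists (fun x => G (e x) x) => x xab.
have [ex xe] := eP x xab; have [_ dG] := GP _ ex.
have Ge : \forall y \near x, G (e x) y = G (e y) y.
  near=> y.
  have yab : y \in `]a, b[ by near: y; exact: near_in_itvoo.
  have yex : y \in `](a + e x), (b - e x)[ by near: y; exact: near_in_itvoo.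
  have [ey ye] := eP y yab.
  have [m [exm eym m2 ym]] : exists m, [/\ e x <= m, e y <= m,
      m < (b - a) / 2 & y \in `](a + m), (b - m)[].
    have [xy|/ltW yx] := leP (e x) (e y).
      by exists (e y); split => //; case/andP: ey.
    by exists (e x); split => //; case/andP: ex.
  have sub z w : e z <= m -> w \in `](a + m), (b - m)[ -> w \in `](a + e z), (b - e z)[.
    by move=> zm; rewrite !in_itv/= => /andP[w1 w2]; apply/andP; split; lra.
  have d1 w : w \in `](a + m), (b - m)[ -> is_derive w 1 (G (e x)) (g w).
    by move=> wm; apply: dG; exact: sub exm wm.
  have d2 w : w \in `](a + m), (b - m)[ -> is_derive w 1 (G (e y)) (g w).
    by move=> wm; apply: (GP _ ey).2; exact: sub eym wm.
  have Gc : G (e x) c = G (e y) c by rewrite (GP _ ex).1 (GP _ ey).1.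
  exact: antiderivative_unique (cE _ m2) ym d1 d2 Gc.
exact: (near_eq_is_derive Ge (dG x xe)).
Unshelve. all: by end_near.
Qed.

(** Milnor's Lobachevsky function, up to an additive constant.  The logarithmic
    singularities at [0] and [pi] stay outside the open interval. *)
Lemma lobachevsky_exists :
  exists L : R -> R, forall x, 0 < x < pi -> is_derive x 1 L (- ln (2 * sin x)).
Proof.
have [|L dL] := @antiderivative_exists (fun x => - ln (2 * sin x)) 0 pi (pi_gt0 R).
  move=> x; rewrite in_itv/= => x0pi; apply: continuousN.
  apply: (continuous_comp (f := fun x => 2 * sin x) (g := @ln R)).
    by apply: continuousM; [exact: cvg_cst | exact: continuous_sin].
  by apply: continuous_ln; rewrite mulr_gt0// sin_gt0_pi.
by exists L => x x0pi; apply: dL; rewrite in_itv.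
Qed.
End Antiderivative.

(** * The angle Jacobian of one triangle *)

Section Triangle.
Context {R : realType} {N : nat}.
Implicit Types (t : {set 'I_N}) (v x y i j : 'I_N) (d l : {set 'I_N} -> R).

(** A labelling of the vertices of [t], along which sums over [t] are expanded. *)
Definition is_corner t v x y :=
  [/\ t = [set v; x; y], v != x, v != y & x != y].

Lemma corner_exists t v : #|t| = 3 -> v \in t -> exists x y, is_corner t v x y.
Proof.
move=> t3 vt; have : #|t :\ v| == 2 by move: t3; rewrite (cardsD1 v) vt add1n => -[->].
move=> /cards2P[x [y [xy txy]]]; exists x, y.
have xt : x \in t :\ v by rewrite txy finset.set21.
have yt : y \in t :\ v by rewrite txy finset.set22.
split=> //; first by rewrite -finset.setUA -txy finset.setD1K.
- by move: xt; rewrite in_setD1 eq_sym => /andP[].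
- by move: yt; rewrite in_setD1 eq_sym => /andP[].
Qed.

Lemma corner_rot t v x y : is_corner t v x y -> is_corner t x y v.
Proof.
case=> -> vx vy xy; split=> //; rewrite 1?eq_sym//.
by rewrite -finset.setUA finset.setUC.
Qed.

Lemma corner_swap t v x y : is_corner t v x y -> is_corner t v y x.
Proof. by case=> -> vx vy xy; split=> //; rewrite 1?eq_sym// finset.setUAC. Qed.

Lemma corner_mem t v x y : is_corner t v x y -> v \in t.
Proof. by case=> -> *; rewrite !inE eqxx. Qed.

Lemma corner_opposite t v x y : is_corner t v x y -> t :\ v = [set x; y].
Proof.
case=> -> vx vy xy; apply/finset.setP => i; rewrite !inE.
by have [->|] := eqVneq i v; rewrite // (negbTE vx) (negbTE vy).
Qed.

Lemma big_corner (S : Type) (idx : S) (op : Monoid.com_law idx) (F : 'I_N -> S) t v x y :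
  is_corner t v x y -> \big[op/idx]_(i in t) F i = op (F v) (op (F x) (F y)).
Proof.
move=> c; rewrite (big_setD1 v) ?(corner_mem c)//= (corner_opposite c).
by case: c => _ _ _ xy; rewrite big_setU1 ?inE//= big_set1.
Qed.

Lemma big_opposite (S : Type) (idx : S) (op : Monoid.com_law idx) (F : 'I_N -> S) t v x y :
  is_corner t v x y -> \big[op/idx]_(i in t :\ v) F i = op (F x) (F y).
Proof.
move=> c; rewrite (corner_opposite c).
by case: c => _ _ _ xy; rewrite big_setU1 ?inE//= big_set1.
Qed.

Lemma corner_sides t v x y : is_corner t v x y ->
  [set v; x] = t :\ y /\ [set v; y] = t :\ x.
Proof.
move=> c; split; first by rewrite (corner_opposite (corner_rot (corner_rot c))).
by rewrite (corner_opposite (corner_rot c)) finset.setUC.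
Qed.

Lemma inner_angle_corner l t v x y : is_corner t v x y ->
  inner_angle l t v = acos (cos_law (l (t :\ v)) (l (t :\ x)) (l (t :\ y))).
Proof.
move=> c; have [vx vy] := corner_sides c.
rewrite /inner_angle /cos_law !(big_opposite _ _ c)/= vx vy.
by rewrite [l (t :\ y) * _]mulrC [l (t :\ y) ^+ 2 + _]addrC.
Qed.

Definition triangle_metric l t :=
  forall v x y, is_corner t v x y ->
    is_triangle (l (t :\ v)) (l (t :\ x)) (l (t :\ y)).

Lemma PL_metric_triangle (T : {set {set 'I_N}}) l t :
  PL_metric T l -> t \in T -> #|t| = 3 -> triangle_metric l t.
Proof.
move=> [lpos ltri] tT t3 v x y c.
have pos z : z \in t -> 0 < l (t :\ z).
  move=> zt; apply: lpos; rewrite inE; apply/andP; split.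
    by move: t3; rewrite (cardsD1 z) zt add1n => -[->].
  by apply/existsP; exists t; rewrite tT finset.subsetDl.
have ineq a b e : is_corner t a b e -> l (t :\ a) < l (t :\ b) + l (t :\ e).
  move=> c'; have := ltri t a tT (corner_mem c').
  rewrite (big_opposite _ _ c')/=; have [-> ->] := corner_sides c'.
  by rewrite addrC.
have c' := corner_rot c; have c'' := corner_rot c'.
split; split; [exact: pos (corner_mem c) | exact: pos (corner_mem c')
  | exact: pos (corner_mem c'') | exact: ineq..].
Qed.

(** The derivative of the angle at [i] in the logarithm of the conformal factor
    at [j]; off the diagonal this is the cotangent of the third angle. *)
Definition angle_jacobian l t i j : R :=
  (if i == j then - (2 * l (t :\ i) ^+ 2)
   else 2 * (l (t :\ i) ^+ 2 + l (t :\ j) ^+ 2) - \sum_(k in t) l (t :\ k) ^+ 2)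
  / Num.sqrt ((\sum_(k in t) l (t :\ k) ^+ 2) ^+ 2
              - 2 * \sum_(k in t) l (t :\ k) ^+ 4).

Lemma angle_jacobian_sym l t i j :
  angle_jacobian l t i j = angle_jacobian l t j i.
Proof.
rewrite /angle_jacobian eq_sym [l (t :\ i) ^+ 2 + _]addrC.
by case: eqP => // ->.
Qed.

Lemma area4_corner l t v x y : is_corner t v x y ->
  Num.sqrt ((\sum_(k in t) l (t :\ k) ^+ 2) ^+ 2
              - 2 * \sum_(k in t) l (t :\ k) ^+ 4) =
  area4 (l (t :\ v)) (l (t :\ x)) (l (t :\ y)).
Proof. by move=> c; rewrite /area4 !(big_corner _ _ c)/= !addrA. Qed.

Lemma angle_jacobian_diag l t v x y : is_corner t v x y ->
  angle_jacobian l t v v =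
  - (2 * l (t :\ v) ^+ 2) / area4 (l (t :\ v)) (l (t :\ x)) (l (t :\ y)).
Proof. by move=> c; rewrite /angle_jacobian eqxx (area4_corner l c). Qed.

Lemma angle_jacobian_offdiag l t v x y : is_corner t v x y ->
  angle_jacobian l t v x =
  (l (t :\ v) ^+ 2 + l (t :\ x) ^+ 2 - l (t :\ y) ^+ 2)
    / area4 (l (t :\ v)) (l (t :\ x)) (l (t :\ y)).
Proof.
move=> c; rewrite /angle_jacobian (area4_corner l c) (big_corner _ _ c)/=.
by case: c => _ /negbTE -> _ _; congr (_ / _); ring.
Qed.

Lemma sum_angle_jacobian l t v : #|t| = 3 -> v \in t ->
  \sum_(i in t) angle_jacobian l t i v = 0.
Proof.
move=> t3 /(corner_exists t3)[x [y c]]; rewrite (big_corner _ _ c)/=.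
rewrite !(angle_jacobian_sym l t _ v) (angle_jacobian_diag l c).
rewrite (angle_jacobian_offdiag l c) (angle_jacobian_offdiag l (corner_swap c)).
have -> : area4 (l (t :\ v)) (l (t :\ y)) (l (t :\ x)) =
          area4 (l (t :\ v)) (l (t :\ x)) (l (t :\ y)).
  by rewrite /area4; congr Num.sqrt; ring.
by rewrite -!mulrDl; apply/eqP; rewrite mulf_eq0; apply/orP; left; apply/eqP; ring.
Qed.

Lemma angle_energy_corner l t v x y (h : 'I_N -> R) : is_corner t v x y ->
  \sum_(i in t) \sum_(j in t) h i * angle_jacobian l t i j * h j =
  - ((l (t :\ v) ^+ 2 + l (t :\ x) ^+ 2 - l (t :\ y) ^+ 2) * (h v - h x) ^+ 2
     + (l (t :\ x) ^+ 2 + l (t :\ y) ^+ 2 - l (t :\ v) ^+ 2) * (h x - h y) ^+ 2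
     + (l (t :\ y) ^+ 2 + l (t :\ v) ^+ 2 - l (t :\ x) ^+ 2) * (h y - h v) ^+ 2)
    / area4 (l (t :\ v)) (l (t :\ x)) (l (t :\ y)).
Proof.
move=> c; have c' := corner_rot c; have c'' := corner_rot c'.
rewrite !(big_corner _ _ c)/=.
rewrite (angle_jacobian_sym l t x v) (angle_jacobian_sym l t v y).
rewrite (angle_jacobian_sym l t y x).
rewrite (angle_jacobian_diag l c) (angle_jacobian_diag l c').
rewrite (angle_jacobian_diag l c'') (angle_jacobian_offdiag l c).
rewrite (angle_jacobian_offdiag l c') (angle_jacobian_offdiag l c'').
rewrite (area4_rot (l (t :\ x)) (l (t :\ y)) (l (t :\ v))).
rewrite (area4_rot (l (t :\ v)) (l (t :\ x)) (l (t :\ y))).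
by move: (area4 _ _ _)^-1 => S; ring.
Qed.

(** The form is a negative multiple of the Dirichlet energy of the linear function
    with vertex values [h].  Completing the square in it leaves a multiple of
    [(h x - h y) ^+ 2] whose coefficient is positive by Heron's formula. *)
Lemma angle_energy_le0 l t (h : 'I_N -> R) : #|t| = 3 -> triangle_metric l t ->
  \sum_(i in t) \sum_(j in t) h i * angle_jacobian l t i j * h j <= 0
    ?= iff [forall i in t, forall j in t, h i == h j].
Proof.
move=> t3 tri; have /card_gt0P[v vt] : (0 < #|t|)%N by rewrite t3.
have [x [y c]] := corner_exists t3 vt.
rewrite (angle_energy_corner l h c).
have abc := tri _ _ _ c; have S0 := area4_gt0 abc; have SE := sqr_area4 abc.
set a := l _ in abc S0 SE *; set b := l _ in abc S0 SE *.
set e := l _ in abc S0 SE *.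
have a0 : 0 < a by case: abc => -[].
set E := (X in - X / _).
have EE : 2 * a ^+ 2 * E =
    (2 * a ^+ 2 * (h v - h x) + (e ^+ 2 + a ^+ 2 - b ^+ 2) * (h x - h y)) ^+ 2
    + (area4 a b e * (h x - h y)) ^+ 2.
  by rewrite [X in _ + X]exprMn SE /E; ring.
have a20 : 0 < 2 * a ^+ 2 by rewrite mulr_gt0// exprn_gt0.
have E0 : 0 <= E.
  by rewrite -(pmulr_rge0 _ a20) EE addr_ge0// sqr_ge0.
split; first by rewrite mulNr oppr_le0 divr_ge0// ltW.
rewrite mulNr oppr_eq0 mulf_eq0 invr_eq0 (gt_eqF S0) orbF.
apply/eqP/idP => [Ez|].
  have /eqP := EE; rewrite Ez mulr0 eq_sym paddr_eq0 ?sqr_ge0//.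
  rewrite !sqrf_eq0 => /andP[XY]; rewrite mulf_eq0 (gt_eqF S0)/= => xy.
  move: XY; rewrite (eqP xy) mulr0 addr0 mulf_eq0 (gt_eqF a20)/= => vx.
  have hE i : i \in t -> h i = h y.
    move: vx xy; rewrite !subr_eq0 => /eqP vx /eqP xy.
    by case: c => -> _ _ _; rewrite !inE => /orP[/orP[]|] /eqP -> //; rewrite vx.
  by apply/forall_inP => i it; apply/forall_inP => j jt; rewrite !hE.
move=> /forall_inP eqh.
have hE i j : i \in t -> j \in t -> h i = h j.
  by move=> it jt; apply/eqP/(forall_inP (eqh i it)).
have xt := corner_mem (corner_rot c).
have yt := corner_mem (corner_rot (corner_rot c)).
by rewrite /E (hE x v)// (hE y v)// subrr expr0n/= !mulr0 !addr0.
Qed.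

End Triangle.

(** * Conformal variation of angles and of the potential of a triangle *)

Section ConformalVariation.
Context {R : realType} {N : nat}.
Implicit Types (t : {set 'I_N}) (v x y i j : 'I_N) (d l : {set 'I_N} -> R).
Implicit Types (T : {set {set 'I_N}}) (J : set R) (h : 'I_N -> R).

(** The curve [log u] has velocity [h].  Both the flow, where [h] is [- K], and the
    lines in logarithmic coordinates are of this kind. *)
Definition has_log_velocity J (u : R -> 'rV[R]_N) (s0 : R) h :=
  forall i, has_derivative_within J (fun s => u s 0 i) s0 (u s0 0 i * h i).

Lemma has_derivative_within_side J (u : R -> 'rV[R]_N) s0 h d t v x y :
  is_corner t v x y -> has_log_velocity J u s0 h ->
  has_derivative_within J (fun s => rescale (u s) d (t :\ v)) s0
    (rescale (u s0) d (t :\ v) * (h x + h y)).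
Proof.
move=> c du; rewrite /rescale.
under [X in has_derivative_within _ X]eq_fun do
  rewrite (big_opposite _ _ c)/= mulrC.
rewrite (big_opposite _ _ c)/=.
have := has_derivative_withinZ (a := d (t :\ v)) (has_derivative_withinM (du x) (du y)).
by congr has_derivative_within; ring.
Qed.

Lemma has_derivative_within_inner_angle J (u : R -> 'rV[R]_N) s0 h d t i :
  #|t| = 3 -> i \in t -> triangle_metric (rescale (u s0) d) t ->
  has_log_velocity J u s0 h ->
  has_derivative_within J (fun s => inner_angle (rescale (u s) d) t i) s0
    (\sum_(j in t) angle_jacobian (rescale (u s0) d) t i j * h j).
Proof.
move=> t3 it tri du; have [x [y c]] := corner_exists t3 it.
have c' := corner_rot c; have c'' := corner_rot c'.
under [X in has_derivative_within _ X]eq_fun do rewrite (inner_angle_corner _ c).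
have := has_derivative_within_angle
  (a := fun s => rescale (u s) d (t :\ i)) (b := fun s => rescale (u s) d (t :\ x))
  (c := fun s => rescale (u s) d (t :\ y)) (tri _ _ _ c)
  (has_derivative_within_side (d := d) c du) (has_derivative_within_side (d := d) c' du)
  (has_derivative_within_side (d := d) c'' du).
congr has_derivative_within; rewrite (big_corner _ _ c)/=.
rewrite (angle_jacobian_diag _ c) (angle_jacobian_offdiag _ c).
rewrite (angle_jacobian_sym _ _ i y) (angle_jacobian_offdiag _ c'').
rewrite (area4_rot (rescale (u s0) d (t :\ x)) (rescale (u s0) d (t :\ y))).
rewrite (area4_rot (rescale (u s0) d (t :\ i)) (rescale (u s0) d (t :\ x))).
by move: (area4 _ _ _)^-1 => S; ring.
Qed.

Lemma inner_angle_itv l t v : #|t| = 3 -> triangle_metric l t -> v \in t ->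
  0 < inner_angle l t v < pi.
Proof.
move=> t3 tri vt; have [x [y c]] := corner_exists t3 vt.
rewrite (inner_angle_corner _ c).
by rewrite acos_cos_law_gt0 ?acos_cos_law_ltpi//; exact: tri.
Qed.

Lemma sum_inner_angle l t : #|t| = 3 -> triangle_metric l t ->
  \sum_(v in t) inner_angle l t v = pi.
Proof.
move=> t3 tri; have /card_gt0P[v vt] : (0 < #|t|)%N by rewrite t3.
have [x [y c]] := corner_exists t3 vt.
have c' := corner_rot c; have c'' := corner_rot c'.
rewrite (big_corner _ _ c)/= (inner_angle_corner _ c) (inner_angle_corner _ c').
by rewrite (inner_angle_corner _ c'') addrA triangle_angle_sum//; exact: tri.
Qed.

(** The first two terms make up the Legendre transform of the volume of the ideal
    hyperbolic tetrahedron with dihedral angles [theta_i]; its derivative in the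
    logarithm of a side is the opposite angle.  The last term turns the sum of the
    other two angles, which appears on differentiating in [ln (u 0 i)], into minus
    the angle at [i]. *)
Definition triangle_potential (L : R -> R) d (u : 'rV[R]_N) t : R :=
  \sum_(i in t) (inner_angle (rescale u d) t i * ln (rescale u d (t :\ i))
                 + L (inner_angle (rescale u d) t i) - pi * ln (u 0 i)).

Lemma has_derivative_within_ln J (x : R -> R) s0 a : 0 < x s0 ->
  has_derivative_within J x s0 (x s0 * a) ->
  has_derivative_within J (fun s => ln (x s)) s0 a.
Proof.
move=> x0 /(has_derivative_within_comp (is_derive1_ln x0)).
by rewrite mulKf// gt_eqF.
Qed.

(** The variation of the angles contributes nothing: by the sine rule
    [ln l_i - ln (2 sin theta_i)] is the same for the three vertices, and the
    angle sum is constant. *)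
Lemma has_derivative_within_triangle_potential (L : R -> R) J
    (u : R -> 'rV[R]_N) s0 h d t :
  (forall a : R, 0 < a < pi -> is_derive a 1 L (- ln (2 * sin a))) ->
  #|t| = 3 -> triangle_metric (rescale (u s0) d) t ->
  (forall i, 0 < u s0 0 i) -> has_log_velocity J u s0 h ->
  has_derivative_within J (fun s => triangle_potential L d (u s) t) s0
    (- \sum_(i in t) inner_angle (rescale (u s0) d) t i * h i).
Proof.
move=> dL t3 tri u0 du.
set l := rescale (u s0) d in tri *.
pose dth i := \sum_(j in t) angle_jacobian l t i j * h j.
have dang i : i \in t -> has_derivative_within J
    (fun s => inner_angle (rescale (u s) d) t i) s0 (dth i).
  by move=> it; exact: has_derivative_within_inner_angle.
pose H := \sum_(j in t) h j.
have lpos i : i \in t -> 0 < l (t :\ i).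
  by move=> it; have [a [b /tri]] := corner_exists t3 it => -[[]].
have dlnl i : i \in t -> has_derivative_within J
    (fun s => ln (rescale (u s) d (t :\ i))) s0 (H - h i).
  move=> it; apply: has_derivative_within_ln; first exact: lpos.
  have [a [b ci]] := corner_exists t3 it.
  have -> : H - h i = h a + h b.
    by rewrite /H (big_corner _ _ ci)/= [LHS]addrC addKr.
  exact: has_derivative_within_side.
(* the circumradius, by the formula a b c / (4 area) *)
pose circ := (\prod_(k in t) l (t :\ k)) /
  Num.sqrt ((\sum_(k in t) l (t :\ k) ^+ 2) ^+ 2
              - 2 * \sum_(k in t) l (t :\ k) ^+ 4).
have circE i : i \in t ->
    ln (l (t :\ i)) - ln (2 * sin (inner_angle l t i)) = ln circ.
  move=> it; have [a [b ci]] := corner_exists t3 it.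
  have abc := tri _ _ _ ci; have S0 := area4_gt0 abc.
  have [a0 b0 c0] : [/\ 0 < l (t :\ i), 0 < l (t :\ a) & 0 < l (t :\ b)] by case: abc.
  rewrite /circ (area4_corner l ci) (big_corner _ _ ci)/= (inner_angle_corner _ ci).
  have sin0 : 0 < 2 * (area4 (l (t :\ i)) (l (t :\ a)) (l (t :\ b)) /
      (2 * (l (t :\ a) * l (t :\ b)))) .
    apply: mulr_gt0 => //; apply: divr_gt0 => //.
    by apply: mulr_gt0 => //; exact: mulr_gt0.
  rewrite sin_acos_cos_law// -ln_div ?posrE//.
  congr ln; move: (area4 _ _ _) S0 => S S0.
  by field; rewrite !gt_eqF.
have dterm i : i \in t -> has_derivative_within J
    (fun s => inner_angle (rescale (u s) d) t i * ln (rescale (u s) d (t :\ i))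
              + L (inner_angle (rescale (u s) d) t i) - pi * ln (u s 0 i)) s0
    (dth i * ln circ + inner_angle l t i * (H - h i) - pi * h i).
  move=> it.
  have dLi := has_derivative_within_comp (dL _ (inner_angle_itv t3 tri it)) (dang i it).
  have dui := has_derivative_within_ln (u0 i) (du i).
  have := has_derivative_withinB (has_derivative_withinD
    (has_derivative_withinM (dang i it) (dlnl i it)) dLi)
    (has_derivative_withinZ (a := pi) dui).
  by congr has_derivative_within; rewrite -(circE i it); ring.
have := has_derivative_within_sum (r := index_enum 'I_N) (P := mem t) dterm.
congr has_derivative_within.
have sum_dth : \sum_(i in t) dth i = 0.
  rewrite exchange_big/= big1// => j jt.
  by rewrite -mulr_suml sum_angle_jacobian// mul0r.
have -> : \sum_(i in t) (dth i * ln circ + inner_angle l t i * (H - h i) - pi * h i)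
  = (\sum_(i in t) dth i) * ln circ + (\sum_(i in t) inner_angle l t i) * H
    - \sum_(i in t) inner_angle l t i * h i - pi * \sum_(i in t) h i.
  rewrite !mulr_suml mulr_sumr -big_split/= -!sumrB/=.
  by apply: eq_bigr => i _; ring.
rewrite sum_dth mul0r add0r sum_inner_angle// -/H.
by rewrite addrAC subrr add0r.
Qed.

End ConformalVariation.

(** * Curvature, its Jacobian and its potential *)

Section Curvature.
Context {R : realType} {N : nat}.
Implicit Types (T : {set {set 'I_N}}) (t : {set 'I_N}) (i j : 'I_N).
Implicit Types (d l : {set 'I_N} -> R) (h : 'I_N -> R).

(** The cotangent Laplacian of the metric [l], with the sign that makes it
    negative semi-definite. *)
Definition angle_matrix T l : 'M[R]_N :=
  \matrix_(i, j) \sum_(t in T | (i \in t) && (j \in t)) angle_jacobian l t i j.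

Lemma angle_matrix_sym T l : (angle_matrix T l)^T = angle_matrix T l.
Proof.
apply/matrixP => i j; rewrite !mxE; apply: eq_big => t; first by rewrite [X in _ && X]andbC.
by move=> _; exact: angle_jacobian_sym.
Qed.

Lemma sum_flags T (F : 'I_N -> {set 'I_N} -> R) :
  \sum_i \sum_(t in T | i \in t) F i t = \sum_(t in T) \sum_(i in t) F i t.
Proof.
rewrite (exchange_big_dep (mem T))/=; last by move=> i t _ /andP[].
by apply: eq_bigr => t tT; apply: eq_bigl => i; rewrite tT.
Qed.

Lemma angle_matrix_mul T l h i :
  \sum_j angle_matrix T l i j * h j =
  \sum_(t in T | i \in t) \sum_(j in t) angle_jacobian l t i j * h j.
Proof.
under eq_bigr do rewrite mxE mulr_suml.
rewrite (exchange_big_dep (fun t => (t \in T) && (i \in t)))/=; last first.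
  by move=> j t _ /and3P[-> -> _].
by apply: eq_bigr => t /andP[tT it]; apply: eq_bigl => j; rewrite tT it.
Qed.

Lemma angle_matrix_form T l h :
  \sum_i \sum_j h i * angle_matrix T l i j * h j =
  \sum_(t in T) \sum_(i in t) \sum_(j in t) h i * angle_jacobian l t i j * h j.
Proof.
rewrite -sum_flags; apply: eq_bigr => i _.
under eq_bigr do rewrite -mulrA.
rewrite -mulr_sumr angle_matrix_mul mulr_sumr; apply: eq_bigr => t _.
by rewrite mulr_sumr; apply: eq_bigr => j _; rewrite mulrA.
Qed.

Lemma angle_matrix_le0 T l h : (forall t, t \in T -> #|t| = 3) -> PL_metric T l ->
  \sum_i \sum_j h i * angle_matrix T l i j * h j <= 0
    ?= iff [forall t in T, forall i in t, forall j in t, h i == h j].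
Proof.
move=> T3 Tl; rewrite angle_matrix_form.
have := leif_sum (fun t (tT : t \in T) =>
  angle_energy_le0 h (T3 t tT) (PL_metric_triangle Tl tT (T3 t tT))).
by rewrite [X in _ <= X ?= iff _]big1.
Qed.

Lemma angle_matrix_nsd T l : (forall t, t \in T -> #|t| = 3) -> PL_metric T l ->
  negative_semidefinite (angle_matrix T l).
Proof.
move=> T3 Tl x; rewrite mxE.
have [+ _] := angle_matrix_le0 (fun i => x 0 i) T3 Tl.
rewrite exchange_big/=; congr (_ <= _); apply: eq_bigr => j _.
by rewrite !mxE mulr_suml.
Qed.

(** If the energy vanishes then [h] is constant on every triangle, hence takes the
    same value at the ends of every edge, and the surface is connected. *)
Lemma angle_matrix_lt0 T l h : triangulates_closed_connected_surface T ->
  PL_metric T l -> (exists i j, h i != h j) ->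
  \sum_i \sum_j h i * angle_matrix T l i j * h j < 0.
Proof.
move=> [N0 T3 lk conn] Tl [v [w hvw]].
rewrite (lt_leif (angle_matrix_le0 h T3 Tl)); apply/negP => /forall_inP eqh.
have eq_edge x y : [set x; y]%SET \in edges T -> h x = h y.
  rewrite inE => /andP[_ /existsP[t /andP[tT /fintype.subsetP et]]].
  have /forall_inP/(_ x) := eqh t tT; rewrite et ?finset.set21// => /(_ isT).
  by move=> /forall_inP/(_ y); rewrite et ?finset.set22// => /(_ isT)/eqP.
move/eqP: hvw; apply; have /connectP[p pth ->] := conn v w.
elim: p v pth => //= x p IH v /andP[vx /IH <-]; exact: eq_edge.
Qed.

Lemma has_derivative_within_K T d (J : set R) (u : R -> 'rV[R]_N) s0 h i :
  (forall t, t \in T -> #|t| = 3) -> PL_metric T (rescale (u s0) d) ->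
  has_log_velocity J u s0 h ->
  has_derivative_within J (fun s => K T d (u s) 0 i) s0
    (- \sum_j angle_matrix T (rescale (u s0) d) i j * h j).
Proof.
move=> T3 Tl du; rewrite angle_matrix_mul.
under [X in has_derivative_within _ X]eq_fun do rewrite mxE /curvature.
rewrite -sub0r; apply: has_derivative_withinB.
  exact: has_derivative_within_cst.
apply: has_derivative_within_sum => t /andP[tT it].
apply: has_derivative_within_inner_angle => //; first exact: T3.
exact: PL_metric_triangle Tl tT (T3 t tT).
Qed.

Definition curvature_potential T (L : R -> R) d (u : 'rV[R]_N) : R :=
  2 * pi * (\sum_i ln (u 0 i)) + \sum_(t in T) triangle_potential L d u t.

Lemma has_derivative_within_curvature_potential T (L : R -> R) d (J : set R)
    (u : R -> 'rV[R]_N) s0 h :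
  (forall a : R, 0 < a < pi -> is_derive a 1 L (- ln (2 * sin a))) ->
  (forall t, t \in T -> #|t| = 3) -> conformal_factor T d (u s0) ->
  has_log_velocity J u s0 h ->
  has_derivative_within J (fun s => curvature_potential T L d (u s)) s0
    (\sum_i K T d (u s0) 0 i * h i).
Proof.
move=> dL T3 [u0 Tl] du.
have dln := has_derivative_withinZ (a := 2 * pi)
  (has_derivative_within_sum (r := index_enum 'I_N) (P := predT)
    (fun i _ => has_derivative_within_ln (u0 i) (du i))).
have dt := has_derivative_within_sum (r := index_enum {set 'I_N}) (P := mem T)
  (fun t tT => has_derivative_within_triangle_potential dL (T3 t tT)
     (PL_metric_triangle Tl tT (T3 t tT)) u0 du).
have := has_derivative_withinD dln dt; congr has_derivative_within.
rewrite sumrN -sum_flags mulr_sumr -sumrB; apply: eq_bigr => i _.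
by rewrite mxE /curvature mulrBl -mulr_suml.
Qed.

Lemma sum_K T d (u : 'rV[R]_N) : (forall t, t \in T -> #|t| = 3) ->
  PL_metric T (rescale u d) ->
  \sum_i K T d u 0 i = 2 * pi * N%:R - pi * #|T|%:R.
Proof.
move=> T3 Tl; under eq_bigr do rewrite mxE /curvature.
rewrite sumrB sumr_const card_ord -[X in X - _]mulr_natr sum_flags; congr (_ - _).
transitivity (\sum_(t in T) (pi : R)); last by rewrite sumr_const mulr_natr.
apply: eq_bigr => t tT.
by rewrite sum_inner_angle//; [exact: T3|exact: PL_metric_triangle Tl tT (T3 t tT)].
Qed.

End Curvature.

(** * Gauss-Bonnet *)

Section EulerCharacteristic.
Context {N : nat}.
Implicit Types (T : {set {set 'I_N}}) (t e : {set 'I_N}) (v x y : 'I_N).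

Lemma next_neq_prev (I : eqType) (s : seq I) (z : I) :
  uniq s -> (2 < size s)%N -> z \in s -> next s z != prev s z.
Proof.
move=> us s2 /rot_to[n s' sE].
rewrite -(next_rot n us) -(prev_rot n us) sE.
have us' : uniq (z :: s') by rewrite -sE rot_uniq.
have : (2 < size (z :: s'))%N by rewrite -sE size_rot.
case: s' us' {sE} => [|a [|b s']]// us' _.
apply/eqP => np; have := next_prev us' z; rewrite -np /= eqxx.
move: us' => /=; rewrite !inE !negb_or => /and3P[/and3P[za zb _] _ _].
by rewrite eq_sym (negbTE za) eqxx => bz; rewrite bz eqxx in zb.
Qed.

(** In the cycle that links [v], the triangles at the edge [v x] correspond to the
    two neighbours of [x], which differ since the cycle has length at least 3. *)
Lemma triangles_at_edge T e : triangulates_closed_connected_surface T ->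
  e \in edges T -> #|[set t in T | e \subset t]%SET| = 2.
Proof.
move=> [_ T3 lk _]; rewrite inE.
move=> /andP[/cards2P[v [x [vx ->{e}]]] /existsP[t0 /andP[t0T et0]]].
have [s [us s2 sT]] := lk v.
have third t : t \in T -> [set v; x]%SET \subset t ->
    exists y, t = [set v; x; y]%SET.
  move=> tT /fintype.subsetP vxt.
  have vt : v \in t by rewrite vxt ?finset.set21.
  have xt : x \in t by rewrite vxt ?finset.set22.
  have [a [b [tE va vb ab]]] := corner_exists (T3 t tT) vt.
  move: xt; rewrite tE !inE eq_sym (negbTE vx)/= => /orP[/eqP ->|/eqP ->].
    by exists b.
  by exists a; rewrite finset.setUAC.
have xs : x \in s.
  have [y t0E] := third t0 t0T et0.
  by move: t0T; rewrite t0E sT => /andP[].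
have -> : [set t in T | [set v; x]%SET \subset t]%SET =
    [set [set v; x; next s x]; [set v; x; prev s x]]%SET.
  apply/finset.setP => t; rewrite !inE; apply/idP/idP.
    move=> /andP[tT /(third t tT)[y tE]]; move: tT; rewrite tE sT => /andP[_].
    by case/orP => /eqP ->; rewrite eqxx ?orbT.
  by case/orP => /eqP ->; rewrite sT xs eqxx ?orbT/=; exact: finset.subsetUl.
rewrite cards2; case: eqP => // same.
have nT : [set v; x; next s x]%SET \in T by rewrite sT xs eqxx.
have : next s x \in [set v; x; prev s x]%SET by rewrite -same !inE eqxx orbT.
rewrite !inE (negbTE (next_neq_prev us s2 xs)) orbF.
have := T3 _ nT => + nE; rewrite (_ : [set v; x; next s x]%SET = [set v; x]%SET).
  by rewrite cards2 vx.
by apply/finset.setP => z; rewrite !inE; case/orP: nE => /eqP ->; do !case: eqP.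
Qed.

(** Each side counts the pairs of a triangle and one of its edges. *)
Lemma double_edges_triple_triangles T :
  triangulates_closed_connected_surface T -> (2 * #|edges T| = 3 * #|T|)%N.
Proof.
move=> hT; have [_ T3 _ _] := hT.
transitivity (\sum_(e in edges T) \sum_(t in T | e \subset t) 1)%N.
  rewrite mulnC -sum_nat_const; apply: eq_bigr => e eT.
  by rewrite sum1dep_card (triangles_at_edge hT eT).
rewrite (exchange_big_dep (mem T))/=; last by move=> e t _ /andP[].
rewrite mulnC -sum_nat_const; apply: eq_bigr => t tT.
have <- : #|[set e : {set 'I_N} | e \subset t & #|e| == 2]%SET| = 3%N.
  by rewrite cards_draws (T3 t tT).
rewrite sum1dep_card; apply: eq_card => e; rewrite !inE tT/=.
have [et|] := boolP (e \subset t); last by rewrite andbF.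
rewrite andbT/= andb_idr// => _.
by apply/existsP; exists t; rewrite tT.
Qed.

Lemma euler_characteristicE (R : numDomainType) T :
  triangulates_closed_connected_surface T ->
  2 * (euler_characteristic T)%:~R = 2 * N%:R - #|T|%:R :> R.
Proof.
move=> hT; have := congr1 (fun n => n%:R : R) (double_edges_triple_triangles hT).
rewrite !natrM /euler_characteristic intrD rmorphB/= -!pmulrn => E.
by rewrite mulrDr mulrBr E; ring.
Qed.

(** The total curvature is [2 * pi * N - pi * #|T|], and [3 * #|T| = 2 * #|E|]. *)
Lemma gauss_bonnet (R : realType) T (d : {set 'I_N} -> R) u :
  triangulates_closed_connected_surface T -> PL_metric T (rescale u d) ->
  \sum_i K T d u 0 i = 2 * pi * (euler_characteristic T)%:~R.
Proof.
move=> hT Tl; have [_ T3 _ _] := hT.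
by rewrite sum_K// [RHS]mulrAC euler_characteristicE//; ring.
Qed.

End EulerCharacteristic.

(** * Convex functions with strictly monotone gradient *)

Section MonotoneGradient.
Context {R : realType} {N : nat}.
Local Open Scope classical_set_scope.
Local Open Scope ring_scope.
Implicit Types (w h k : 'rV[R]_N) (s r : R).

Definition dotr h k : R := \sum_i h 0 i * k 0 i.

Lemma dotrDl h1 h2 k : dotr (h1 + h2) k = dotr h1 k + dotr h2 k.
Proof. by rewrite -big_split; apply: eq_bigr => i _; rewrite mxE mulrDl. Qed.

Lemma dotrNl h k : dotr (- h) k = - dotr h k.
Proof. by rewrite /dotr -sumrN; apply: eq_bigr => i _; rewrite mxE mulNr. Qed.

Lemma dotrNr h k : dotr h (- k) = - dotr h k.
Proof. by rewrite /dotr -sumrN; apply: eq_bigr => i _; rewrite mxE mulrN. Qed.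

Lemma dotrBl h1 h2 k : dotr (h1 - h2) k = dotr h1 k - dotr h2 k.
Proof. by rewrite dotrDl dotrNl. Qed.

Lemma dotrZr a h k : dotr h (a *: k) = a * dotr h k.
Proof. by rewrite /dotr mulr_sumr; apply: eq_bigr => i _; rewrite mxE mulrCA. Qed.

Lemma dotrDr h k1 k2 : dotr h (k1 + k2) = dotr h k1 + dotr h k2.
Proof. by rewrite -big_split; apply: eq_bigr => i _; rewrite mxE mulrDr. Qed.

Lemma dotrr_le0 h : dotr h h <= 0 -> h = 0.
Proof.
move=> hh; have h0 i : 0 <= h 0 i * h 0 i by rewrite -expr2 sqr_ge0.
have : dotr h h = 0 by apply/le_anti; rewrite hh sumr_ge0.
move=> /eqP; rewrite psumr_eq0// => /allP hi; apply/rowP => i; rewrite mxE.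
by have := hi i (mem_index_enum i); rewrite mulf_eq0 orbb => /eqP.
Qed.

Lemma coord_le_norm w i : `|w 0 i| <= `|w|.
Proof.
rewrite [leRHS]/Num.Def.normr/= mx_normrE.
exact: (le_bigmax _ (fun ij : 'I_1 * 'I_N => `|w ij.1 ij.2|) (0, i)).
Qed.

Lemma dotr_le h k : dotr h k <= N%:R * `|h| * `|k|.
Proof.
apply: (@le_trans _ _ (\sum_(i < N) `|h| * `|k|)).
  apply: ler_sum => i _; apply: (le_trans (ler_norm _)); rewrite normrM.
  by apply: ler_pM => //; exact: coord_le_norm.
by rewrite sumr_const card_ord -mulrA mulr_natl.
Qed.

Lemma cvg_row (T : Type) (F : set_system T) {FF : Filter F} (u : T -> 'rV[R]_N) w :
  (forall i, u x 0 i @[x --> F] --> w 0 i) -> u @ F --> w.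
Proof.
move=> uw; apply/cvgrPdist_le => e e0; near=> x.
rewrite [leLHS]/Num.Def.normr/= mx_normrE (bigmax_le _ (ltW e0))//= => -[j i] _.
rewrite !mxE/= ord1; move: i; near: x; apply: filter_forall => i.
by move/cvgrPdist_le : (uw i) => /(_ e e0).
Unshelve. all: by end_near.
Qed.

Lemma cvg_coord (T : Type) (F : set_system T) {FF : Filter F} (u : T -> 'rV[R]_N) w i :
  u @ F --> w -> u x 0 i @[x --> F] --> w 0 i.
Proof.
move=> uw.
exact: (cvg_comp u (fun w => w 0 i) uw (@coord_continuous _ _ _ 0 i w)).
Qed.

Lemma cvg_fsum (T I : Type) (F : set_system T) {FF : Filter F} (r : seq I) (P : pred I)
    (f : I -> T -> R) (l : I -> R) :
  (forall i, P i -> f i x @[x --> F] --> l i) ->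
  \sum_(i <- r | P i) f i x @[x --> F] --> \sum_(i <- r | P i) l i.
Proof.
move=> fl; elim: r => [|i r IH].
  by rewrite big_nil; under eq_fun do rewrite big_nil; exact: cvg_cst.
rewrite big_cons; under eq_fun do rewrite big_cons.
by case: ifP => // Pi; apply: cvgD => //; exact: fl.
Qed.

Lemma cvg_dotr (T : Type) (F : set_system T) {FF : Filter F} (u v : T -> 'rV[R]_N) h k :
  u @ F --> h -> v @ F --> k -> dotr (u x) (v x) @[x --> F] --> dotr h k.
Proof.
by move=> uh vk; apply: cvg_fsum => i _; apply: cvgM; exact: cvg_coord.
Qed.

Lemma derive_ge0_of_min (g : R -> R) (a e : R) :
  0 < e -> is_derive (0 : R) 1 g a ->
  (forall s, 0 <= s <= e -> g 0 <= g s) -> 0 <= a.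
Proof.
move=> e0 /is_derive1_caratheodory[q [gq cq <-]] gmin; rewrite leNgt; apply/negP => q0.
have qneg : \forall s \near (0 : R)^'+, q s < 0.
  have : \forall s \near nbhs (0 : R), q s < 0 by apply: (cvgr_lt _ cq).
  exact: cvg_at_right_filter.
have [s [qs s0 se]] : exists s, [/\ q s < 0, 0 < s & s <= e].
  apply: (@filter_ex _ (0 : R)^'+); near=> s; split; near: s => //.
  - exact: nbhs_right_gt.
  - exact: nbhs_right_le.
have := gmin s; rewrite (ltW s0) se => /(_ isT).
by rewrite -subr_ge0 gq subr0 pmulr_lge0// leNgt qs.
Unshelve. all: by end_near.
Qed.

Definition is_constant_row h := forall i j, h 0 i = h 0 j.

(** [G] is the gradient of [f], in the form of its slopes along lines; it is
    strictly monotone except in the direction of the constant vectors, where the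
    curvature does not change.  [Omega] need not be convex, so monotonicity is
    asked only along segments inside it. *)
Record monotone_gradient (Omega : set 'rV[R]_N) (f : 'rV[R]_N -> R)
    (G : 'rV[R]_N -> 'rV[R]_N) : Prop := MonotoneGradient {
  mg_open : open Omega;
  mg_slope : forall w h, Omega w ->
    is_derive (0 : R) 1 (fun s : R => f (w + s *: h)) (dotr (G w) h);
  mg_continuous : forall w, Omega w -> {for w, continuous f};
  mg_gradient_continuous : forall w, Omega w -> {for w, continuous G};
  mg_mono : forall w h, (forall s, 0 <= s <= 1 -> Omega (w + s *: h)) ->
    0 <= dotr (G (w + h) - G w) h;
  mg_strict : forall w h, (forall s, 0 <= s <= 1 -> Omega (w + s *: h)) ->
    ~ is_constant_row h -> 0 < dotr (G (w + h) - G w) h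
}.

(** The mean values of the derivative on either side of [s] compare like the
    derivative itself. *)
Lemma chord_above (g D : R -> R) s :
  (forall u : R, 0 <= u <= 1 -> is_derive u 1 g (D u)) ->
  (forall a b : R, 0 <= a -> a <= b -> b <= 1 -> D a <= D b) ->
  0 <= s <= 1 -> g s <= s * g 1 + (1 - s) * g 0.
Proof.
move=> gD Dmono /andP[s0 s1].
have [->|s_neq0] := eqVneq s 0; first by rewrite mul0r add0r subr0 mul1r.
have [->|s_neq1] := eqVneq s 1; first by rewrite subrr mul0r addr0 mul1r.
have s0' : 0 < s by rewrite lt_neqAle eq_sym s_neq0.
have s1' : s < 1 by rewrite lt_neqAle s_neq1.
have [|a + gs] := has_derivative_within_MVT (x := g) (l := D) s0'.
  move=> u; rewrite in_itv/= => /andP[u0 us]; apply: has_derivative_within_is_derive.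
  by apply: gD; rewrite u0 (le_trans us).
have [|b + gs'] := has_derivative_within_MVT (x := g) (l := D) s1'.
  move=> u; rewrite in_itv/= => /andP[u0 us]; apply: has_derivative_within_is_derive.
  by apply: gD; rewrite us (le_trans s0).
rewrite !in_itv/= => /andP[/ltW sb /ltW b1] /andP[/ltW a0 /ltW as'].
have Dab := Dmono a b a0 (le_trans as' sb) b1.
have : D a * (s * (1 - s)) <= D b * (s * (1 - s)).
  by rewrite ler_wpM2r// mulr_ge0// subr_ge0.
move: gs gs'; rewrite subr0 => gs gs' DD.
have e1 : (g s - g 0) * (1 - s) = D a * (s * (1 - s)) by rewrite gs mulrA.
have e2 : (g 1 - g s) * s = D b * (s * (1 - s)) by rewrite gs' -mulrA [_ * s]mulrC.
by move: DD; rewrite -e1 -e2; lra.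
Qed.

Lemma ball_segment w0 w w' r s : `|w - w0| < r -> `|w' - w0| < r -> 0 <= s <= 1 ->
  `|w + s *: (w' - w) - w0| < r.
Proof.
move=> wr w'r /andP[s0 s1].
have -> : w + s *: (w' - w) - w0 = (1 - s) *: (w - w0) + s *: (w' - w0).
  by apply/rowP => i; rewrite !mxE; ring.
apply: (le_lt_trans (ler_normD _ _)); rewrite !normrZ ger0_norm ?subr_ge0// ger0_norm//.
have [->|s_neq1] := eqVneq s 1; first by rewrite subrr mul0r add0r mul1r.
have s1' : s < 1 by rewrite lt_neqAle s_neq1.
have : (1 - s) * `|w - w0| < (1 - s) * r by rewrite ltr_pM2l// subr_gt0.
have : s * `|w' - w0| <= s * r by rewrite ler_wpM2l// ltW.
by lra.
Qed.

Context (Omega : set 'rV[R]_N) (f : 'rV[R]_N -> R) (G : 'rV[R]_N -> 'rV[R]_N).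
Context (mg : monotone_gradient Omega f G).

Lemma slope_along w h s : Omega (w + s *: h) ->
  is_derive s 1 (fun s => f (w + s *: h)) (dotr (G (w + s *: h)) h).
Proof.
move=> ws; have d := mg_slope mg h ws.
have -> : (fun s => f (w + s *: h)) =
    (fun s' => f (w + s *: h + s' *: h)) \o (fun s' => s' - s).
  by apply/funext => s' /=; congr f; rewrite -addrA -scalerDl [s + _]addrC subrK.
rewrite -[X in is_derive _ _ _ X]mulr1; apply: is_derive1_comp.
  by rewrite subrr.
by rewrite -[X in is_derive _ _ _ X]subr0; apply: is_deriveB.
Qed.

Lemma slope_mono w h a b : (forall s, 0 <= s <= 1 -> Omega (w + s *: h)) ->
  0 <= a -> a <= b -> b <= 1 ->
  dotr (G (w + a *: h)) h <= dotr (G (w + b *: h)) h.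
Proof.
move=> wO a0 ab b1; have [->//|a_neq_b] := eqVneq a b.
have ab' : 0 < b - a by rewrite subr_gt0 lt_neqAle a_neq_b.
rewrite -subr_ge0 -dotrBl -(pmulr_rge0 _ ab') -dotrZr.
have -> : w + b *: h = w + a *: h + (b - a) *: h.
  by rewrite -addrA -scalerDl [a + _]addrC subrK.
apply: (mg_mono mg) => s /andP[s0 s1]; rewrite -addrA scalerA -scalerDl.
apply: wO; apply/andP; split; first by rewrite addr_ge0// mulr_ge0// ltW.
by have := ler_wpM2r (ltW ab') s1; lra.
Qed.

Lemma convex_on_ball w0 r : (forall w, `|w - w0| < r -> Omega w) ->
  convex_function [set w | `|w - w0| < r] f.
Proof.
move=> BO t x y; rewrite !inE/= => xB yB.
(* [t] weighs [x], so the segment is run from [y] to [x] *)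
pose h := x - y; pose s : R := t%:num.
have hO u : 0 <= u <= 1 -> Omega (y + u *: h) by move=> u01; apply: BO; exact: ball_segment.
have s01 : 0 <= s <= 1 by rewrite /s ge0 le1.
have -> : conv t x y = y + s *: h.
  by rewrite /conv/= scalerBl scalerBr scale1r addrCA.
have := chord_above (g := fun s => f (y + s *: h)) (fun u u01 => slope_along (hO u u01))
  (fun a b => @slope_mono y h a b hO) s01.
by rewrite scale0r addr0 scale1r [y + h]addrC subrK convRE.
Qed.

Lemma shift_continuous w0 : continuous (fun w => w - w0).
Proof.
move=> w; apply: (@cvgB R 'rV[R]_N _ (nbhs w) _ id (cst w0) w w0).
  exact: cvg_id.
exact: cvg_cst.
Qed.

Lemma coord_sum_continuous : continuous (fun w => \sum_i w 0 i).
Proof.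
move=> w; apply: (@cvg_fsum _ _ (nbhs w)) => i _; exact: coord_continuous.
Qed.

Lemma dist_continuous w0 : continuous (fun w => `|w - w0|).
Proof. by move=> w; exact: (cvg_norm (@shift_continuous w0 w)). Qed.

(** The part of the closed ball on which the gradient is strictly monotone: the
    hyperplane meets the direction of the constant vectors only in zero. *)
Definition slice w0 r : set 'rV[R]_N :=
  [set w | `|w - w0| <= r] `&` [set w | \sum_i w 0 i = 0].

Lemma slice_compact w0 r : compact (slice w0 r).
Proof.
apply: bounded_closed_compact.
  exists (`|w0| + r); split; first exact: num_real.
  move=> x rx w [/= wr _]; apply/ltW; apply: le_lt_trans rx.
  apply: (@le_trans _ _ (`|w0| + `|w - w0|)); last by rewrite lerD2l.
  by rewrite -{1}(subrK w0 w) addrC ler_normD.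
apply: closedI.
  apply: (closed_comp (f := fun w => `|w - w0|) (D := [set x | x <= r]));
    last exact: closed_le.
  by move=> w _; exact: dist_continuous.
apply: (closed_comp (f := fun w => \sum_i w 0 i) (D := [set x | x = 0]));
  last exact: closed_eq.
by move=> w _; exact: coord_sum_continuous.
Qed.

Lemma slice_segment w0 r w w' s : slice w0 r w -> slice w0 r w' -> 0 <= s <= 1 ->
  slice w0 r (w + s *: (w' - w)).
Proof.
move=> [/= wr w0s] [/= w'r w'0s] /andP[s0 s1]; split => /=.
  have -> : w + s *: (w' - w) - w0 = (1 - s) *: (w - w0) + s *: (w' - w0).
    by apply/rowP => i; rewrite !mxE; ring.
  apply: (le_trans (ler_normD _ _)); rewrite !normrZ ger0_norm ?subr_ge0// ger0_norm//.
  have : (1 - s) * `|w - w0| <= (1 - s) * r by rewrite ler_wpM2l// subr_ge0.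
  have : s * `|w' - w0| <= s * r by rewrite ler_wpM2l.
  by lra.
under eq_bigr do rewrite !mxE.
by rewrite big_split/= -mulr_sumr sumrB w0s w'0s subrr mulr0 addr0.
Qed.

Lemma constant_row_sum0 h : is_constant_row h -> \sum_i h 0 i = 0 -> h = 0.
Proof.
move=> hc hs; apply/rowP => i; rewrite mxE; move/eqP: hs.
rewrite (eq_bigr (fun=> h 0 i)) => [|j _]; last exact: hc.
rewrite sumr_const card_ord mulrn_eq0 => /orP[/eqP N0|/eqP//].
by have := leq_ltn_trans (leq0n _) (ltn_ord i); rewrite [X in (_ < X)%N]N0.
Qed.

Lemma slice_strict w0 r w w' : (slice w0 r `<=` Omega) ->
  slice w0 r w -> slice w0 r w' -> w != w' -> 0 < dotr (G w' - G w) (w' - w).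
Proof.
move=> CO Cw Cw' ww'; rewrite -{1}(subrK w w') [w' - w + w]addrC.
apply: (mg_strict mg) => [s s01|hc]; first by apply: CO; exact: slice_segment.
move/eqP: ww'; apply; apply/esym/eqP; rewrite -subr_eq0; apply/eqP.
apply: constant_row_sum0 => //.
under eq_bigr do rewrite !mxE.
by rewrite sumrB; case: Cw => _ /= ->; case: Cw' => _ /= ->; rewrite subrr.
Qed.

(** Strict monotonicity makes [G w - G w0] point outwards on the boundary sphere,
    by a margin that is positive by compactness; [k] may use up this margin. *)
Lemma outward_on_sphere w0 r : 0 < r -> \sum_i w0 0 i = 0 -> slice w0 r `<=` Omega ->
  exists2 e, 0 < e & forall k w, `|k - G w0| < e -> slice w0 r w -> `|w - w0| = r ->
    0 < dotr (G w - k) (w - w0).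
Proof.
move=> r0 w00 CO.
pose S := slice w0 r `&` [set w | r <= `|w - w0|].
have w0C : slice w0 r w0 by split => /=; rewrite ?subrr ?normr0// ltW.
have [m m0 mP] : exists2 m, 0 < m & forall w, S w -> m <= dotr (G w - G w0) (w - w0).
  have [[w1 Sw1]|S0] := pselect (S !=set0); last first.
    by exists 1 => // w Sw; exfalso; apply: S0; exists w.
  have cS : compact S.
    have Sclosed : closed S.
      apply: closedI.
        exact: compact_closed (@norm_hausdorff _ _) (@slice_compact w0 r).
      apply: (closed_comp (f := fun w => `|w - w0|) (D := [set x | r <= x])).
        by move=> w _; exact: dist_continuous.
      exact: closed_ge.
    by apply: subclosed_compact Sclosed (@slice_compact w0 r) _ => w [].
  have [||w /[!inE] Sw wmin] :=
    @EVT_min_rV R N (fun w => dotr (G w - G w0) (w - w0)) S _ cS.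
  - by exists w1.
  - apply: continuous_in_subspaceT => w /[!inE] -[/CO Ow _].
    have cG : (fun w => G w - G w0) @ nbhs w --> G w - G w0.
      apply: (@cvgB R 'rV[R]_N _ (nbhs w) _ G (cst (G w0))); last exact: cvg_cst.
      exact: (mg_gradient_continuous mg Ow).
    exact: (cvg_dotr cG (@shift_continuous w0 w)).
  exists (dotr (G w - G w0) (w - w0)) => [|w' Sw']; last by apply: wmin; rewrite inE.
  case: Sw => Cw /= rw; apply: slice_strict CO w0C Cw _.
  by apply/eqP => ww0; move: rw; rewrite ww0 subrr normr0 leNgt r0.
have Nr : 0 < N%:R * r + 1 by rewrite ltr_wpDl// mulr_ge0// ltW.
exists (m / (N%:R * r + 1)) => [|k w kG Cw wr]; first by rewrite divr_gt0.
have Sw : S w by split => //=; rewrite wr.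
have -> : G w - k = (G w - G w0) - (k - G w0) by rewrite opprB addrA subrK.
rewrite dotrBl subr_gt0; apply: lt_le_trans (mP w Sw).
apply: (le_lt_trans (dotr_le _ _)); rewrite wr mulrAC.
move: kG; rewrite ltr_pdivlMr// mulrC => kG; apply: le_lt_trans kG.
by rewrite mulrDl mul1r lerDl.
Qed.

(** The minimum [w] of [f - dotr k] over the slice is not on the boundary sphere,
    where the slope towards the centre is negative.  So its slopes in the
    directions of sum zero vanish, and [G w - k] is itself such a direction. *)
Lemma gradient_surjective w0 r k : 0 < r -> \sum_i w0 0 i = 0 ->
  slice w0 r `<=` Omega ->
  (forall w, slice w0 r w -> `|w - w0| = r -> 0 < dotr (G w - k) (w - w0)) ->
  (forall w, Omega w -> \sum_i G w 0 i = \sum_i k 0 i) ->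
  exists w, [/\ `|w - w0| < r, \sum_i w 0 i = 0 & G w = k].
Proof.
move=> r0 w00 CO outward Gsum.
have w0C : slice w0 r w0 by split => /=; rewrite ?subrr ?normr0// ltW.
pose phi w := f w - dotr k w.
have [||w /[!inE] Cw wmin] := @EVT_min_rV R N phi (slice w0 r) _ (@slice_compact w0 r).
- by exists w0.
- apply: continuous_in_subspaceT => w /[!inE] /CO Ow.
  apply: (@cvgB R R _ (nbhs w) _ f (dotr k)); first exact: (mg_continuous mg Ow).
  by apply: (@cvg_dotr _ (nbhs w) _ (cst k) id k w); [exact: cvg_cst | exact: cvg_id].
have dphi h : is_derive (0 : R) 1 (fun s : R => phi (w + s *: h)) (dotr (G w - k) h).
  rewrite dotrBl; apply: (@is_deriveB _ _ _ (fun s : R => f (w + s *: h))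
    (fun s : R => dotr k (w + s *: h))); first exact (mg_slope mg h (CO _ Cw)).
  have -> : (fun s : R => dotr k (w + s *: h)) = (fun s => dotr k w + s * dotr k h).
    by apply/funext => s; rewrite dotrDr dotrZr.
  apply/is_derive1_caratheodory; exists (cst (dotr k h)); split => //.
  - by move=> s; rewrite subr0 mul0r addr0 addrC addKr mulrC.
  - exact: cst_continuous.
have slope h e : 0 < e -> (forall s, 0 <= s <= e -> slice w0 r (w + s *: h)) ->
    0 <= dotr (G w - k) h.
  move=> e0 hC; apply: derive_ge0_of_min e0 (dphi h) _ => s s0e.
  by rewrite scale0r addr0; apply: wmin; rewrite inE; exact: hC.
have wr : `|w - w0| < r.
  rewrite lt_neqAle; case: (Cw) => /= -> _; rewrite andbT; apply/eqP => wr.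
  have := slope (w0 - w) 1 ltr01 (fun s => slice_segment Cw w0C).
  by rewrite -(opprB w w0) dotrNr oppr_ge0 leNgt outward.
exists w; split => //; first by case: Cw.
apply/eqP; rewrite -subr_eq0; apply/eqP; apply: dotrr_le0.
set h := G w - k.
have hs : \sum_i h 0 i = 0.
  by under eq_bigr do rewrite !mxE; rewrite sumrB (Gsum _ (CO _ Cw)) subrr.
(* [- h] has slope [- dotr h h], and small steps along it stay in the slice *)
rewrite -oppr_ge0 -dotrNr.
pose e := (r - `|w - w0|) / (`|h| + 1).
have h1 : 0 < `|h| + 1 by rewrite ltr_wpDl.
have e0 : 0 < e by rewrite divr_gt0// subr_gt0.
apply: (slope _ e e0) => s /andP[s0 se]; split => /=.
  rewrite addrAC; apply: (le_trans (ler_normD _ _)); rewrite normrZ normrN ger0_norm//.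
  rewrite -lerBrDl; apply: (@le_trans _ _ (e * (`|h| + 1))).
    by rewrite ler_pM// lerDl.
  by rewrite /e divfK// gt_eqF.
under eq_bigr do rewrite 3!mxE; rewrite big_split/= -mulr_sumr sumrN.
by rewrite hs; case: Cw => _ /= ->; rewrite oppr0 mulr0 addr0.
Qed.

Lemma slice_injective w0 r w w' : slice w0 r `<=` Omega ->
  slice w0 r w -> slice w0 r w' -> G w = G w' -> w = w'.
Proof.
move=> CO Cw Cw' Gww'; apply/eqP/negPn/negP => ww'.
have := slice_strict CO Cw Cw' ww'; rewrite Gww' subrr.
by rewrite /dotr big1 ?ltxx// => i _; rewrite mxE mul0r.
Qed.

(** The image of the compact set of points of the slice outside a neighbourhood of
    [g k] is closed and, by injectivity, does not contain [k]. *)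
Lemma gradient_inverse_continuous w0 r (B : set 'rV[R]_N) (g : 'rV[R]_N -> 'rV[R]_N) k :
  slice w0 r `<=` Omega ->
  (forall x, B x -> slice w0 r (g x) /\ G (g x) = x) -> B k ->
  g x @[x --> within B (nbhs k)] --> g k.
Proof.
move=> CO gP Bk A Ak.
pose C' := slice w0 r `&` ~` A°.
have cC' : compact C'.
  have C'closed : closed C'.
    apply: closedI; first exact: compact_closed (@norm_hausdorff _ _) (@slice_compact w0 r).
    by apply: open_closedC; exact: open_interior.
  by apply: subclosed_compact C'closed (@slice_compact w0 r) _ => w [].
have cGC' : compact (G @` C').
  apply: continuous_compact cC'; apply: continuous_in_subspaceT => w /[!inE] -[/CO Ow _].
  exact: (mg_gradient_continuous mg Ow).
have openGC' : open (~` (G @` C')).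
  by apply: closed_openC; exact: compact_closed (@norm_hausdorff _ _) cGC'.
have kGC' : (~` (G @` C')) k.
  move=> [w [Cw nAw] Gw]; apply: nAw; have [Cgk Ggk] := gP k Bk.
  by rewrite (slice_injective CO Cw Cgk) ?Gw.
suff : \forall x \near within B (nbhs k), A (g x) by [].
rewrite near_withinE; apply: filterS (open_nbhs_nbhs (conj openGC' kGC')) => x nGx Bx.
have [Cgx Ggx] := gP x Bx; apply: contrapT => nA; apply: nGx; exists (g x) => //.
by split => // /interior_subset.
Qed.

Lemma gradient_local_inverse chi w0 : Omega w0 -> \sum_i w0 0 i = 0 ->
  (forall w, Omega w -> \sum_i G w 0 i = chi) ->
  exists r (W : set 'rV[R]_N) (g : 'rV[R]_N -> 'rV[R]_N),
    [/\ 0 < r /\ (forall w, `|w - w0| < r -> Omega w),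
        open W /\ W (G w0),
        forall k, W k -> \sum_i k 0 i = chi ->
          [/\ `|g k - w0| < r, \sum_i g k 0 i = 0 & G (g k) = k],
        forall w, `|w - w0| < r -> \sum_i w 0 i = 0 -> g (G w) = w
      & forall k, W k -> \sum_i k 0 i = chi ->
          g x @[x --> within ([set x : 'rV[R]_N | \sum_i x 0 i = chi] `&` W)
                        (nbhs k)] --> g k].
Proof.
move=> Ow0 w00 Gsum.
have [r r0 rO] : exists2 r, 0 < r & forall w, `|w - w0| <= r -> Omega w.
  have /nbhs_ballP[e /= e0 eO] : nbhs w0 Omega.
    by apply: open_nbhs_nbhs; split => //; exact: mg_open mg.
  exists (e / 2) => [|w we]; first by rewrite divr_gt0.
  apply: eO; rewrite -ball_normE /= distrC; apply: le_lt_trans we _.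
  by rewrite ltr_pdivrMr// ltr_pMr// ltr1n.
have CO : slice w0 r `<=` Omega by move=> w [/rO].
have [e e0 eP] := outward_on_sphere r0 w00 CO.
(* [P k] selects the unique preimage of [k] in the open ball *)
pose P k w := [/\ `|w - w0| < r, \sum_i w 0 i = 0 & G w = k].
have PC k w : P k w -> slice w0 r w by case=> wr ws _; split => //=; exact: ltW.
have /choice[g gP] : forall k, exists w, (exists w', P k w') -> P k w.
  move=> k; have [[w Pw]|nP] := pselect (exists w, P k w); first by exists w.
  by exists w0 => /nP.
have gWP k : `|k - G w0| < e -> \sum_i k 0 i = chi -> P k (g k).
  move=> ke ks; apply: gP; apply: gradient_surjective => // [w Cw wr|w Ow].
    exact: eP.
  by rewrite Gsum.
exists r, [set k | `|k - G w0| < e], g; split.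
- by split => // w /ltW; exact: rO.
- split; last by rewrite /= subrr normr0.
  apply: (@open_comp _ _ (fun k => `|k - G w0|) [set x | x < e]); last exact: open_lt.
  by move=> k _; exact: dist_continuous.
- by move=> k; exact: gWP.
- move=> w wr ws; have Pw : P (G w) w by split.
  have Pg : P (G w) (g (G w)) by apply: gP; exists w.
  by apply: slice_injective CO (PC _ _ Pg) (PC _ _ Pw) _; case: Pg.
- move=> k Wk ks; apply: gradient_inverse_continuous CO _ _; last by split.
  by move=> x [/= xs Wx]; have Pg := gWP x Wx xs; split; [exact: PC Pg | case: Pg].
Qed.

End MonotoneGradient.

(** * Differentiability in the conformal factors *)

Section Regularity.
Context {R : realType} {N : nat} {V : normedModType R}.
Local Open Scope classical_set_scope.
Local Open Scope ring_scope.
Implicit Types (p q : V) (t e : {set 'I_N}) (d : {set 'I_N} -> R).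
Implicit Types (T : {set {set 'I_N}}).

Lemma differentiable_mul (f g : V -> R) p :
  differentiable f p -> differentiable g p -> differentiable (fun q => f q * g q) p.
Proof. by move=> df dg; exact: (differentiableM df dg). Qed.

Lemma differentiable_add (f g : V -> R) p :
  differentiable f p -> differentiable g p -> differentiable (fun q => f q + g q) p.
Proof. by move=> df dg; exact: (differentiableD df dg). Qed.

Lemma differentiable_sub (f g : V -> R) p :
  differentiable f p -> differentiable g p -> differentiable (fun q => f q - g q) p.
Proof. by move=> df dg; exact: (differentiableB df dg). Qed.

Lemma differentiable_outer (F : R -> R) (f : V -> R) p (l : R) :
  is_derive (f p) 1 F l -> differentiable f p -> differentiable (fun q => F (f q)) p.
Proof.
move=> [dF _] df; apply: (@differentiable_comp _ _ _ _ f F) => //.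
exact/derivable1_diffP.
Qed.

Lemma differentiable_bigsum (I : Type) (r : seq I) (P : pred I) (f : I -> V -> R) p :
  (forall i, P i -> differentiable (f i) p) ->
  differentiable (fun q => \sum_(i <- r | P i) f i q) p.
Proof.
move=> df; elim: r => [|i r IH].
  by under eq_fun do rewrite big_nil; exact: differentiable_cst.
under eq_fun do rewrite big_cons.
have [Pi|_] := boolP (P i); last exact: IH.
by apply: differentiable_add => //; exact: df.
Qed.

Context (phi : V -> 'rV[R]_N) (p : V).
Context (dphi : forall i, differentiable (fun q => phi q 0 i) p).

Lemma differentiable_side d t v x y : is_corner t v x y ->
  differentiable (fun q => rescale (phi q) d (t :\ v)) p.
Proof.
move=> c; rewrite /rescale; apply: differentiable_mul; last exact: differentiable_cst.
have -> : (fun q => \prod_(i in t :\ v) phi q 0 i) = (fun q => phi q 0 x * phi q 0 y).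
  by apply/funext => q; rewrite (big_opposite _ _ c).
exact: differentiable_mul.
Qed.

Lemma differentiable_inner_angle d t i : #|t| = 3 -> i \in t ->
  triangle_metric (rescale (phi p) d) t ->
  differentiable (fun q => inner_angle (rescale (phi q) d) t i) p.
Proof.
move=> t3 it tri; have [x [y c]] := corner_exists t3 it.
have c' := corner_rot c; have c'' := corner_rot c'.
under eq_fun do rewrite (inner_angle_corner _ c).
have abc := tri _ _ _ c.
apply: (@differentiable_outer acos (fun q => cos_law (rescale (phi q) d (t :\ i))
  (rescale (phi q) d (t :\ x)) (rescale (phi q) d (t :\ y))) p
  _ (is_derive1_acos (cos_law_itv abc))).
have dsqr z a b : is_corner t z a b ->
    differentiable (fun q => rescale (phi q) d (t :\ z) ^+ 2) p.
  by move=> cz; apply: differentiable_mul; exact: differentiable_side cz.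
apply: differentiable_mul.
  apply: differentiable_sub; last exact: dsqr c.
  by apply: differentiable_add; [exact: dsqr c'|exact: dsqr c''].
apply: (@differentiable_comp _ _ _ _ (fun q => 2 * (rescale (phi q) d (t :\ x) *
  rescale (phi q) d (t :\ y))) GRing.inv).
  apply: differentiable_mul; first exact: differentiable_cst.
  apply: differentiable_mul; first exact: differentiable_side c'.
  exact: differentiable_side c''.
apply: differentiable_Rinv.
by case: abc => -[a0 b0 c0] _; rewrite gt_eqF//=; do 2 apply: mulr_gt0 => //.
Qed.

Lemma differentiable_triangle_potential (L : R -> R) d t :
  (forall a : R, 0 < a < pi -> is_derive a 1 L (- ln (2 * sin a))) ->
  #|t| = 3 -> triangle_metric (rescale (phi p) d) t -> (forall i, 0 < phi p 0 i) ->
  differentiable (fun q => triangle_potential L d (phi q) t) p.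
Proof.
move=> dL t3 tri u0; apply: differentiable_bigsum => i it.
have dang := differentiable_inner_angle t3 it tri.
have [a [b ci]] := corner_exists t3 it.
have l0 : 0 < rescale (phi p) d (t :\ i) by have [[]] := tri _ _ _ ci.
apply: differentiable_sub; first apply: differentiable_add.
- apply: differentiable_mul => //.
  by apply: (differentiable_outer (is_derive1_ln l0)); exact: differentiable_side ci.
- exact: (differentiable_outer (dL _ (inner_angle_itv t3 tri it))).
- apply: differentiable_mul; first exact: differentiable_cst.
  exact: (differentiable_outer (f := fun q => phi q 0 i) (is_derive1_ln (u0 i))).
Qed.

Lemma differentiable_curvature_potential T (L : R -> R) d :
  (forall a : R, 0 < a < pi -> is_derive a 1 L (- ln (2 * sin a))) ->
  (forall t, t \in T -> #|t| = 3) -> conformal_factor T d (phi p) ->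
  differentiable (fun q => curvature_potential T L d (phi q)) p.
Proof.
move=> dL T3 [u0 Tl]; apply: differentiable_add.
  apply: differentiable_mul; first exact: differentiable_cst.
  apply: differentiable_bigsum => i _.
  exact: (differentiable_outer (f := fun q => phi q 0 i) (is_derive1_ln (u0 i))).
apply: differentiable_bigsum => t tT.
apply: differentiable_triangle_potential => //; first exact: T3.
exact: PL_metric_triangle Tl tT (T3 t tT).
Qed.

Lemma continuous_K T d : (forall t, t \in T -> #|t| = 3) ->
  PL_metric T (rescale (phi p) d) -> {for p, continuous (fun q => K T d (phi q))}.
Proof.
move=> T3 Tl; apply: cvg_row => i; rewrite mxE; under eq_fun do rewrite mxE.
have dc : differentiable (fun q => curvature T (rescale (phi q) d) i) p.
  apply: differentiable_sub; first exact: differentiable_cst.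
  apply: differentiable_bigsum => t /andP[tT it].
  apply: differentiable_inner_angle => //; first exact: T3.
  exact: PL_metric_triangle Tl tT (T3 t tT).
exact: (differentiable_continuous dc).
Qed.

Lemma differentiable_rescale d e : differentiable (fun q => rescale (phi q) d e) p.
Proof.
apply: differentiable_mul; last exact: differentiable_cst.
elim: (index_enum _) => [|i r IH].
  by under eq_fun do rewrite big_nil; exact: differentiable_cst.
under eq_fun do rewrite big_cons.
have [ie|_] := boolP (i \in e); last exact: IH.
exact: differentiable_mul.
Qed.

(** Finitely many strict inequalities between continuous functions. *)
Lemma near_conformal_factor T d : conformal_factor T d (phi p) ->
  \forall q \near p, conformal_factor T d (phi q).
Proof.
move=> [u0 [lpos ltri]].
have near_gt0 (f : V -> R) : differentiable f p -> 0 < f p -> \forall q \near p, 0 < f q.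
  by move=> /differentiable_continuous fc; exact: (cvgr_gt _ fc).
have near1 : \forall q \near p, forall i, 0 < phi q 0 i.
  by apply: filter_forall => i; exact: near_gt0.
have near2 : \forall q \near p, forall e, e \in edges T -> 0 < rescale (phi q) d e.
  apply: filter_forall => e; have [eT|_] := boolP (e \in edges T); last exact: nearW.
  have := near_gt0 _ (differentiable_rescale d e) (lpos e eT).
  by apply: filterS => q ? _.
have near3 : \forall q \near p, forall tv : {set 'I_N} * 'I_N,
    tv.1 \in T -> tv.2 \in tv.1 ->
    rescale (phi q) d (tv.1 :\ tv.2) <
    \sum_(x in tv.1 :\ tv.2) rescale (phi q) d [set tv.2; x]%SET.
  apply: filter_forall => -[t v]/=.
  have [tT|_] := boolP (t \in T); last exact: nearW.
  have [vt|_] := boolP (v \in t); last exact: nearW.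
  have : 0 < \sum_(x in t :\ v) rescale (phi p) d [set v; x]%SET
             - rescale (phi p) d (t :\ v).
    by rewrite subr_gt0; exact: ltri.
  move=> /(near_gt0 (fun q => \sum_(x in t :\ v) rescale (phi q) d [set v; x]%SET
      - rescale (phi q) d (t :\ v))) H.
  apply: filterS (H _) => [q|]; first by rewrite subr_gt0.
  apply: differentiable_sub; last exact: differentiable_rescale.
  by apply: differentiable_bigsum => x _; exact: differentiable_rescale.
apply: filterS3 near1 near2 near3 => q h1 h2 h3; split => //; split => // t v tT vt.
exact: (h3 (t, v)).
Qed.

End Regularity.

(** * Logarithmic coordinates *)

Section LogCoordinates.
Context {R : realType} {N : nat}.
Local Open Scope classical_set_scope.
Local Open Scope ring_scope.
Implicit Types (u w h : 'rV[R]_N) (T : {set {set 'I_N}}) (d : {set 'I_N} -> R).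

Lemma exp_coordsK : cancel (@exp_coords R N) (@log_coords R N).
Proof. by move=> w; apply/rowP => i; rewrite !mxE expRK. Qed.

Lemma log_coordsK u : (forall i, 0 < u 0 i) -> exp_coords (log_coords u) = u.
Proof. by move=> u0; apply/rowP => i; rewrite !mxE lnK// posrE. Qed.

Lemma exp_coords_gt0 w i : 0 < exp_coords w 0 i.
Proof. by rewrite mxE expR_gt0. Qed.

Lemma prod_exp_coords w : \prod_i exp_coords w 0 i = expR (\sum_i w 0 i).
Proof. by rewrite expR_sum; apply: eq_bigr => i _; rewrite mxE. Qed.

Lemma differentiable_exp_coords w i : differentiable (fun w => exp_coords w 0 i) w.
Proof.
under eq_fun do rewrite mxE.
apply: (differentiable_outer (F := expR) (f := fun w => w 0 i) (is_derive_expR (w 0 i))).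
exact: differentiable_coord.
Qed.

Lemma continuous_exp_coords : continuous (@exp_coords R N).
Proof.
move=> w; apply: (@cvg_row _ _ _ (nbhs w)) => i.
exact: (differentiable_continuous (differentiable_exp_coords w i)).
Qed.

Lemma continuous_log_coords u :
  (forall i, 0 < u 0 i) -> {for u, continuous (@log_coords R N)}.
Proof.
move=> u0; apply: (@cvg_row _ _ _ (nbhs u)) => i; rewrite mxE; under eq_fun do rewrite mxE.
exact: (continuous_comp (@coord_continuous _ _ _ 0 i u) (continuous_ln (u0 i))).
Qed.

Lemma has_log_velocity_line w h s :
  has_log_velocity setT (fun s => exp_coords (w + s *: h)) s (fun i => h 0 i).
Proof.
move=> i; under [X in has_derivative_within _ X]eq_fun do rewrite !mxE.
rewrite !mxE; apply: (has_derivative_within_comp (F := expR)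
  (x := fun s => w 0 i + s * h 0 i) (is_derive_expR _)).
have := has_derivative_withinD (has_derivative_within_cst setT (w 0 i) s)
  (has_derivative_withinM (has_derivative_within_id setT s)
     (has_derivative_within_cst setT (h 0 i) s)).
by rewrite add0r mul1r mulr0 addr0.
Qed.

Definition conformal_domain T d : set 'rV[R]_N :=
  [set w | PL_metric T (rescale (exp_coords w) d)].

Lemma conformal_domainE T d w :
  conformal_domain T d w -> conformal_factor T d (exp_coords w).
Proof. by move=> wO; split => // i; exact: exp_coords_gt0. Qed.

Lemma conformal_domain_log T d u :
  conformal_factor T d u -> conformal_domain T d (log_coords u).
Proof. by move=> [u0 uT]; rewrite /conformal_domain /= log_coordsK. Qed.

(** The second variation of the potential along a line: a positive multiple of the
    Dirichlet energy of the piecewise linear function with vertex values [h]. *)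
Lemma has_derivative_within_K_line T d w h s : (forall t, t \in T -> #|t| = 3) ->
  conformal_domain T d (w + s *: h) ->
  has_derivative_within setT (fun s => dotr (K T d (exp_coords (w + s *: h))) h) s
    (- \sum_i \sum_j h 0 i *
       angle_matrix T (rescale (exp_coords (w + s *: h)) d) i j * h 0 j).
Proof.
move=> T3 ws.
have dK i := has_derivative_withinM
  (has_derivative_within_K (u := fun s => exp_coords (w + s *: h)) (i := i) T3 ws
    (@has_log_velocity_line w h s))
  (has_derivative_within_cst setT (h 0 i) s).
have := has_derivative_within_sum (r := index_enum 'I_N) (P := predT) (fun i _ => dK i).
congr has_derivative_within; rewrite -sumrN; apply: eq_bigr => i _.
rewrite mulr0 addr0 mulNr mulr_suml; congr (- _).
by apply: eq_bigr => j _; rewrite mulrC mulrA.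
Qed.

Lemma K_mono T d w h : (forall t, t \in T -> #|t| = 3) ->
  (forall s : R, 0 <= s <= 1 -> conformal_domain T d (w + s *: h)) ->
  exists2 s : R, conformal_domain T d (w + s *: h) &
    dotr (K T d (exp_coords (w + h)) - K T d (exp_coords w)) h =
    - \sum_i \sum_j h 0 i *
       angle_matrix T (rescale (exp_coords (w + s *: h)) d) i j * h 0 j.
Proof.
move=> T3 wO.
have [|s s01] := has_derivative_within_MVT
  (x := fun s => dotr (K T d (exp_coords (w + s *: h))) h)
  (l := fun s => - \sum_i \sum_j h 0 i *
       angle_matrix T (rescale (exp_coords (w + s *: h)) d) i j * h 0 j) (@ltr01 R).
  move=> s; rewrite in_itv/= => s01.
  by apply: has_derivative_withinS (has_derivative_within_K_line T3 (wO s s01)).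
rewrite scale1r scale0r addr0 subr0 mulr1 => E; exists s.
  by apply: wO; move: s01; rewrite in_itv/= => /andP[/ltW -> /ltW ->].
by rewrite dotrBl E.
Qed.

(** The mean value theorem along a segment turns the sign of the second variation
    into monotonicity of the curvature. *)
Lemma K_monotone_gradient (L : R -> R) T d :
  (forall a : R, 0 < a < pi -> is_derive a 1 L (- ln (2 * sin a))) ->
  triangulates_closed_connected_surface T ->
  monotone_gradient (conformal_domain T d)
    (fun w => curvature_potential T L d (exp_coords w))
    (fun w => K T d (exp_coords w)).
Proof.
move=> dL hT; have [_ T3 _ _] := hT; split.
- rewrite openE => w wO; rewrite /interior.
  have := near_conformal_factor (differentiable_exp_coords w) (conformal_domainE wO).
  by apply: filterS => w' [].
- move=> w h wO.
  have wO0 : conformal_domain T d (w + 0 *: h) by rewrite scale0r addr0.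
  have := has_derivative_within_curvature_potential dL T3 (conformal_domainE wO0)
    (@has_log_velocity_line w h 0).
  rewrite scale0r addr0 => H; apply: is_derive_of_within H; exact: filterT.
- move=> w wO; apply: differentiable_continuous.
  exact: (differentiable_curvature_potential (differentiable_exp_coords w) dL T3
    (conformal_domainE wO)).
- move=> w wO; exact: (continuous_K (differentiable_exp_coords w) T3 wO).
- move=> w h wO; have [s ws ->] := K_mono T3 wO.
  by rewrite oppr_ge0; case: (angle_matrix_le0 (fun i => h 0 i) T3 ws).
- move=> w h wO hc; have [s ws ->] := K_mono T3 wO.
  rewrite oppr_gt0; apply: angle_matrix_lt0 => //.
  apply: contrapT => nh; apply: hc => i j; apply/eqP/negPn/negP => hij.
  by apply: nh; exists i, j.
Qed.

End LogCoordinates.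

(** * The flow and the curvature map *)

Section YamabeFlow.
Context {R : realType} {N : nat}.
Local Open Scope classical_set_scope.
Local Open Scope ring_scope.
Implicit Types (T : {set {set 'I_N}}) (d : {set 'I_N} -> R) (J : set R).

Lemma flow_log_velocity T d J (u : R -> 'rV[R]_N) s : yamabe_flow T d J u -> J s ->
  has_log_velocity J u s (fun i => - K T d (u s) 0 i).
Proof. by move=> flow Js i; rewrite mulrN; exact: (flow s Js).2. Qed.

Lemma flow_curvature_derivative T d J (u : R -> 'rV[R]_N) s i :
  (forall t, t \in T -> #|t| = 3) -> yamabe_flow T d J u -> J s ->
  has_derivative_within J (fun s => K T d (u s) 0 i) s
    (\sum_(j < N) angle_matrix T (rescale (u s) d) i j * K T d (u s) 0 j).
Proof.
move=> T3 flow Js; have [[_ uT] _] := flow s Js.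
have := has_derivative_within_K (i := i) T3 uT (flow_log_velocity flow Js).
congr has_derivative_within; rewrite -sumrN.
by apply: eq_bigr => j _; rewrite mulrN opprK.
Qed.

(** The derivative of the sum of squares is twice the form of the negative
    semi-definite matrix [angle_matrix] at the curvature. *)
Lemma flow_curvature_norm_decreasing T d J (u : R -> 'rV[R]_N) s t :
  (forall t, t \in T -> #|t| = 3) -> is_interval J -> yamabe_flow T d J u ->
  J s -> J t -> s <= t ->
  \sum_(i < N) K T d (u t) 0 i ^+ 2 <= \sum_(i < N) K T d (u s) 0 i ^+ 2.
Proof.
move=> T3 Jitv flow Js Jt; rewrite le_eqVlt => /orP[/eqP->//|st].
have stJ : `[s, t] `<=` J.
  by move=> x /=; rewrite in_itv/= => xst; exact: (Jitv s t Js Jt x xst).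
pose D x := \sum_(i < N) (2 * K T d (u x) 0 i *
  \sum_(j < N) angle_matrix T (rescale (u x) d) i j * K T d (u x) 0 j).
have [|x xst E] := has_derivative_within_MVT
    (x := fun x => \sum_(i < N) K T d (u x) 0 i ^+ 2) (l := D) st.
  move=> x xst; apply: (has_derivative_withinS stJ).
  apply: has_derivative_within_sum => i _; apply: has_derivative_within_sqr.
  by apply: flow_curvature_derivative => //; exact: stJ.
have /flow[[_ uT] _] : J x by apply: stJ; exact: subset_itv_oo_cc xst.
rewrite -subr_le0 E pmulr_lle0 ?subr_gt0//.
have -> : D x = 2 * \sum_i \sum_j K T d (u x) 0 i *
    angle_matrix T (rescale (u x) d) i j * K T d (u x) 0 j.
  rewrite /D mulr_sumr; apply: eq_bigr => i _; rewrite -mulrA !mulr_sumr.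
  by apply: eq_bigr => j _; rewrite !mulrA.
rewrite pmulr_rle0//.
by case: (angle_matrix_le0 (fun i => K T d (u x) 0 i) T3 uT).
Qed.

Lemma yamabe_flow_logE T d J (u : R -> 'rV[R]_N) :
  (forall s, J s -> conformal_factor T d (u s)) ->
  yamabe_flow T d J u <-> forall s, J s -> forall i,
    has_derivative_within J (fun s => log_coords (u s) 0 i) s (- K T d (u s) 0 i).
Proof.
move=> uJ; split=> [flow s Js i|flow s Js].
  under [X in has_derivative_within _ X]eq_fun do rewrite mxE.
  have [[u0 _] _] := flow s Js.
  exact: (has_derivative_within_ln (x := fun s => u s 0 i) (u0 i)
    (flow_log_velocity flow Js (i := i))).
split; first exact: uJ.
move=> i; have [u0 _] := uJ s Js.
have uE x : J x -> expR (log_coords (u x) 0 i) = u x 0 i.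
  by move=> Jx; have [ux0 _] := uJ x Jx; rewrite mxE lnK// posrE.
have := has_derivative_within_comp (F := expR) (is_derive_expR _) (flow s Js i).
rewrite uE// mulrN => du.
exact: (has_derivative_within_eq (x := fun x => expR (log_coords (u x) 0 i))
  (y := fun x => u x 0 i) Js uE du).
Qed.

Lemma derive_of_slope (f : 'rV[R]_N -> R) w h (a : R) :
  is_derive (0 : R) 1 (fun s : R => f (w + s *: h)) a -> 'D_h f w = a.
Proof.
case=> _ <-; rewrite /derive.
have -> // : (fun s : R => s^-1 *: ((f \o shift w) (s *: h) - f w)) =
  (fun s : R => s^-1 *: (((fun s : R => f (w + s *: h)) \o shift 0) (s *: 1)
                         - f (w + 0 *: h))).
by apply/funext => s /=; rewrite addr0 scale0r addr0 [s *: 1]mulr1 [s *: h + w]addrC.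
Qed.

Lemma dotr_delta (k : 'rV[R]_N) i : dotr k (delta_mx 0 i) = k 0 i.
Proof.
rewrite /dotr (bigD1 i)//= mxE !eqxx mulr1 big1 ?addr0// => j ji.
by rewrite mxE (negbTE ji) andbF mulr0.
Qed.

(** The logarithm carries the surface where the product of the [u_i] is 1 to the
    hyperplane where the sum of the [w_i] vanishes; the local inverse found there
    is transported back by the exponential. *)
Lemma K_local_homeomorphism T d : triangulates_closed_connected_surface T ->
  local_homeomorphism
    [set u : 'rV[R]_N | conformal_factor T d u /\ \prod_(i < N) u 0 i = 1]
    [set k : 'rV[R]_N |
       \sum_(i < N) k 0 i = 2 * pi * (euler_characteristic T)%:~R]
    (K T d).
Proof.
move=> hT; have [_ T3 _ _] := hT; split.
  by move=> u [[_ uT] _]; exact: gauss_bonnet.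
have [L dL] := @lobachevsky_exists R.
move=> u0 [u0T u01]; have mg := K_monotone_gradient d dL hT.
have sum_log u : conformal_factor T d u -> \prod_i u 0 i = 1 ->
    \sum_i log_coords u 0 i = 0.
  move=> [u_gt0 _] u1; apply: expR_inj; rewrite expR0 -u1 -prod_exp_coords.
  by rewrite log_coordsK.
have [r [W [g [[r0 rO] [oW Ww0] gP gK gc]]]] := gradient_local_inverse mg
  (conformal_domain_log u0T) (sum_log _ u0T u01)
  (fun w wO => gauss_bonnet hT wO).
set B := [set k : 'rV[R]_N | _] in gc *.
have w0E : exp_coords (log_coords u0) = u0 by rewrite log_coordsK//; case: u0T.
pose U := [set u : 'rV[R]_N | [/\ forall i, 0 < u 0 i,
  `|log_coords u - log_coords u0| < r & W (K T d u)]].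
have UT u : U u -> conformal_factor T d u.
  by move=> [u_gt0 /rO/conformal_domainE]; rewrite log_coordsK.
have cK u : conformal_factor T d u -> {for u, continuous (K T d)}.
  by move=> [_ uT]; exact: (continuous_K (fun i => differentiable_coord u 0 i) T3 uT).
exists U, W, (fun k => exp_coords (g k)); split.
- split; last first.
    split; [by case: u0T | by rewrite subrr normr0 | by rewrite -w0E].
  rewrite openE => u Uu; have [u_gt0 ur Wu] := Uu.
  have near1 : nbhs u [set v : 'rV[R]_N | forall i, 0 < v 0 i].
    apply: (@filter_forall _ _ (fun i => [set v : 'rV[R]_N | 0 < v 0 i]) (nbhs u)) => i.
    by apply: (cvgr_gt _ (@coord_continuous _ _ _ 0 i u)).
  have near2 : nbhs u [set v : 'rV[R]_N | `|log_coords v - log_coords u0| < r].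
    have c := continuous_comp (continuous_log_coords u_gt0)
      (@dist_continuous _ _ (log_coords u0) (log_coords u)).
    exact: (cvgr_lt _ c).
  have near3 : nbhs u [set v : 'rV[R]_N | W (K T d v)].
    by apply: (cK u (UT u Uu)); exact: open_nbhs_nbhs.
  by apply: filterS3 near1 near2 near3 => v ? ? ?; split.
- split => //; apply/seteqP; split => [k [u [[uT u1] [_ _ Wu]] <-]|k [Bk Wk]].
    by split => //; case: uT => _; exact: gauss_bonnet.
  have [gr gs GgK] := gP k Wk Bk.
  exists (exp_coords (g k)) => //; split.
    by split; [exact/conformal_domainE/rO | rewrite prod_exp_coords gs expR0].
  by split; [exact: exp_coords_gt0 | rewrite exp_coordsK | rewrite GgK].
- move=> u [[uT u1] [u_gt0 ur _]].
  have := gK _ ur (sum_log u uT u1); rewrite log_coordsK// => ->.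
  by rewrite log_coordsK.
- by apply: continuous_in_subspaceT => u /[!inE] -[[uT _] _]; exact: cK.
- apply/subspace_continuousP => k [Bk Wk].
  exact: (cvg_comp _ _ (gc k Wk Bk) (@continuous_exp_coords _ _ (g k))).
Qed.

End YamabeFlow.

Unset Implicit Arguments.
Local Open Scope classical_set_scope.
Local Open Scope ring_scope.

Theorem theorem1p2 (R : realType) (N : nat) (T : {set {set 'I_N}})
    (hT : triangulates_closed_connected_surface T)
    (d : {set 'I_N} -> R) (hd : PL_metric T d) :
  (* (a) *)
  ((exists c : 'rV[R]_N -> 'M[R]_N,
      (forall u, conformal_factor T d u ->
         (c u)^T = c u /\ negative_semidefinite (c u)) /\
      (forall (J : set R) (u : R -> 'rV[R]_N),
         is_interval J -> J 0 -> yamabe_flow T d J u ->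
         (forall i, u 0 0 i = 1) ->
         forall t, J t -> forall i,
           has_derivative_within J (fun s => K T d (u s) 0 i) t
             (\sum_(j < N) c (u t) i j * K T d (u t) 0 j))) /\
   (forall (J : set R) (u : R -> 'rV[R]_N),
      is_interval J -> J 0 -> yamabe_flow T d J u ->
      (forall i, u 0 0 i = 1) ->
      forall s t, J s -> J t -> s <= t ->
        \sum_(i < N) K T d (u t) 0 i ^+ 2
          <= \sum_(i < N) K T d (u s) 0 i ^+ 2)) /\
  (* (b) *)
  (let Omega := [set w : 'rV[R]_N | PL_metric T (rescale (exp_coords w) d)] in
   open Omega /\
   exists f : 'rV[R]_N -> R,
     [/\ locally_convex_on Omega f,
         (forall w, Omega w -> differentiable f w)
       & (forall (J : set R) (u : R -> 'rV[R]_N),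
            is_interval J -> (forall t, J t -> conformal_factor T d (u t)) ->
            (yamabe_flow T d J u <->
             negative_gradient_flow f J (fun t => log_coords (u t))))]) /\
  (* (c) *)
  local_homeomorphism
    [set u : 'rV[R]_N | conformal_factor T d u /\ \prod_(i < N) u 0 i = 1]
    [set k : 'rV[R]_N |
       \sum_(i < N) k 0 i = 2 * pi * (euler_characteristic T)%:~R]
    (K T d).
Proof.
have [_ T3 _ _] := hT; have [L dL] := @lobachevsky_exists R.
have mg := K_monotone_gradient d dL hT.
split; [|split; last exact: K_local_homeomorphism]; split.
- exists (fun u => angle_matrix T (rescale u d)); split=> [u [_ uT]|].
    by split; [exact: angle_matrix_sym | exact: angle_matrix_nsd].
  by move=> J u _ _ flow _ t Jt i; exact: flow_curvature_derivative.
- by move=> J u Jitv _ flow _ s t; exact: flow_curvature_norm_decreasing.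
- exact: mg_open mg.
exists (fun w => curvature_potential T L d (exp_coords w)); split.
- move=> w wO.
  have /nbhs_ballP[r /= r0 rO] : nbhs w (conformal_domain T d).
    by apply: open_nbhs_nbhs; split => //; exact: mg_open mg.
  have ballE : ball w r = [set w' | `|w' - w| < r].
    by rewrite -ball_normE; apply/seteqP; split => w' /=; rewrite distrC.
  exists (ball w r); split => //.
  + exact: nbhsx_ballx.
  + rewrite ballE => x y t; rewrite !inE/= => xr yr.
    have -> : conv t x y = y + t%:num *: (x - y).
      by rewrite /conv/= scalerBl scalerBr scale1r addrCA.
    by apply: ball_segment => //; rewrite ge0 le1.
  + by rewrite ballE; apply: (convex_on_ball mg) => w' ww'; apply: rO; rewrite ballE.
- move=> w wO.
  exact: (differentiable_curvature_potential (differentiable_exp_coords w) dL T3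
    (conformal_domainE wO)).
- move=> J u _ uJ.
  have DE s i : J s -> 'D_(delta_mx 0 i)
      (fun w => curvature_potential T L d (exp_coords w)) (log_coords (u s)) =
      K T d (u s) 0 i.
    move=> Js; have slope := mg_slope mg (delta_mx 0 i) (conformal_domain_log (uJ s Js)).
    rewrite (derive_of_slope slope) dotr_delta log_coordsK//.
    by have [] := uJ s Js.
  apply: (iff_trans (yamabe_flow_logE uJ)).
  by split=> flow s Js i; have := flow s Js i; rewrite DE.
Qed.
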